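(* Let $n\ge3$, $\alpha\in(0,n)$, let $\mathbf A=(A_i)_{i\in I}$ be a generalized condenser in $\mathbb R^n$ and $\boldsymbol\sigma\in\mathfrak C(\mathbf A)$. Assume that for every $i\in I$, $\kappa_\alpha(\cdot,\sigma^i)$ is (finitely) continuous on $A_i$ and upper bounded on some neighborhood of $\omega_{\mathbb R^n}$ (the point at infinity), and $$\sigma^i(A_i\setminus\dot A_i^\delta)=0.$$ If moreover Case I takes place and $$g_i(x)\le M_i<\infty\quad\text{for all }x\in\mathbb R^n,\ i\in I,$$ then for any given $\boldsymbol\lambda\in\mathcal E^{\boldsymbol\sigma}_{\alpha,\mathbf f}(\mathbf A,\mathbf a,\mathbf g)$ the following two assertions are equivalent: (i) $\boldsymbol\lambda\in\mathfrak S^{\boldsymbol\sigma}_{\alpha,\mathbf f}(\mathbf A,\mathbf a,\mathbf g)$. (ii) There exists $(w^i_{\boldsymbol\lambda})_{i\in I}\in\mathbb R^{|I|}$ such that for all $i\in I$ $$W^{\boldsymbol\lambda,i}_{\alpha,\mathbf f}\ge w^i_{\boldsymbol\lambda}g_i\quad(\sigma^i-\lambda^i)\text{-a.e. on }A_i,$$ $$W^{\boldsymbol\lambda,i}_{\alpha,\mathbf f}\le w^i_{\boldsymbol\lambda}g_i\quad\text{everywhere on the support }S(\lambda^i).$$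
   Context: $\kappa_\alpha(x,y)=|x-y|^{\alpha-n}$; $\kappa_\alpha(x,\mu)=\int|x-y|^{\alpha-n}d\mu(y)$, $\kappa_\alpha(\mu,\nu)=\iint|x-y|^{\alpha-n}d\mu(x)d\nu(y)$. $c_\alpha(Q)=[\inf\kappa_\alpha(\mu,\mu)]^{-1}$ over positive Radon measures $\mu$ of finite energy carried by $Q$ with $\mu(Q)=1$. Generalized condenser $\mathbf A=(A_i)_{i\in I}$: $I$ finite, $A_i\subset\mathbb R^n$ nonempty closed with prescribed signs $s_i=\pm1$, $c_\alpha(A_i)>0$ for all $i$, and $c_\alpha(\delta_{\mathbf A})=0$, where $\delta_{\mathbf A}=A^+\cap A^-$ and $A^\pm=\bigcup_{s_i=\pm1}A_i$. $\mathfrak M^+(\mathbf A)$: all $\boldsymbol\mu=(\mu^i)_{i\in I}$ with $\mu^i$ a positive Radon measure supported by $A_i$. $\mathcal E^+_\alpha(\mathbf A)$: those with $\kappa_\alpha(\mu^i,\mu^i)<\infty$ for all $i$. $\kappa_\alpha(\boldsymbol\mu,\boldsymbol\mu)=\sum_{i,j}s_is_j\kappa_\alpha(\mu^i,\mu^j)$. External field $\mathbf f=(f_i)_{i\in I}$; Case I means that every $f_i:\mathbb R^n\to[0,\infty]$ is lower semicontinuous. $\dot A_i^\delta:=\{x\in A_i\setminus\delta_{\mathbf A}:|f_i(x)|<\infty\}$. $G_{\alpha,\mathbf f}(\boldsymbol\mu)=\kappa_\alpha(\boldsymbol\mu,\boldsymbol\mu)+2\sum_i\int f_i\,d\mu^i$.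 The $\mathbf f$-weighted vector potential of $\boldsymbol\mu$ has components $W^{\boldsymbol\mu,i}_{\alpha,\mathbf f}(x)=\sum_{j\in I}s_is_j\kappa_\alpha(x,\mu^j)+f_i(x)$, $i\in I$. $\mathbf a=(a_i)$, $a_i>0$; $\mathbf g=(g_i)$ with $g_i:\mathbb R^n\to(0,\infty)$ continuous and $\inf g_i>0$. $\mathfrak C(\mathbf A)$: all $\boldsymbol\sigma=(\sigma^i)_{i\in I}\in\mathfrak M^+(\mathbf A)$ with $\int g_i\,d\sigma^i>a_i$ and support of $\sigma^i$ equal to $A_i$ for all $i$. $\mathcal E^{\boldsymbol\sigma}_{\alpha,\mathbf f}(\mathbf A,\mathbf a,\mathbf g)$: all $\boldsymbol\mu\in\mathcal E^+_\alpha(\mathbf A)$ with $G_{\alpha,\mathbf f}(\boldsymbol\mu)$ finite, $\mu^i\le\sigma^i$ and $\int g_i\,d\mu^i=a_i$ for all $i$. $\mathfrak S^{\boldsymbol\sigma}_{\alpha,\mathbf f}(\mathbf A,\mathbf a,\mathbf g)$: the set of those $\boldsymbol\lambda$ in this class at which $G_{\alpha,\mathbf f}$ attains its infimum over the class. *)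

(* Defs.v *)
From HB Require Import structures.
From mathcomp Require Import all_boot all_order all_algebra.
From mathcomp Require Import all_classical all_reals all_analysis.
Set Implicit Arguments.
Unset Strict Implicit.
Unset Printing Implicit Defensive.
Import Order.TTheory GRing.Theory Num.Theory.
Import numFieldNormedType.Exports.
Local Open Scope classical_set_scope.
Local Open Scope ring_scope.

Section measure_difference.
Local Open Scope ereal_scope.
Context d (T : measurableType d) (R : realType).
Variables nu mu : {measure set T -> \bar R}.

(* When [mu] is sigma-finite and [mu <= nu], this is the unique measure whose
   sum with [mu] is [nu] (see [mdiffE]); [nu B - mu B] itself is
   meaningless when both terms are infinite.  Without [mu <= nu] it is the
   positive part of the signed measure [nu - mu]. *)
Definition mdiff (B : set T) : \bar R :=
  ereal_sup [set nu C - mu C | C in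
    [set C | [/\ measurable C, C `<=` B & mu C < +oo]]].

Lemma mdiff_ub (B C : set T) : measurable C -> C `<=` B -> mu C < +oo ->
  nu C - mu C <= mdiff B.
Proof. by move=> mC CB Coo; apply: ereal_sup_ubound; exists C. Qed.

Let mdiff0 : mdiff set0 = 0.
Proof.
apply/eqP; rewrite eq_le; apply/andP; split.
  apply: ge_ereal_sup => _ [C [_ + _] <-]; rewrite subset0 => ->.
  by rewrite !measure0 sube0.
have := @mdiff_ub set0 set0 measurable0 (@subset_refl _ _).
by rewrite !measure0 sube0; apply.
Qed.

Let mdiff_ge0 B : 0 <= mdiff B.
Proof.
have := @mdiff_ub B set0 measurable0 (@sub0set _ _).
by rewrite !measure0 sube0; apply.
Qed.

Let le_mdiff A B : A `<=` B -> mdiff A <= mdiff B.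
Proof.
move=> AB; apply: ge_ereal_sup => _ [C [mC CA Coo] <-].
by apply: mdiff_ub => //; exact: subset_trans AB.
Qed.

Let mdiff_superadd A B : A `&` B = set0 ->
  mdiff A + mdiff B <= mdiff (A `|` B).
Proof.
move=> AB0; set Z := mdiff (A `|` B).
have step C D : measurable C -> C `<=` A -> mu C < +oo ->
    measurable D -> D `<=` B -> mu D < +oo ->
    (nu C - mu C) + (nu D - mu D) <= Z.
  move=> mC CA Coo mD DB Doo.
  have CD0 : C `&` D = set0.
    by rewrite -subset0 -AB0; exact: setISS.
  have nuCD : nu (C `|` D) = nu C + nu D by rewrite measureU.
  have muCD : mu (C `|` D) = mu C + mu D by rewrite measureU.
  have Cf : mu C \is a fin_num by rewrite ge0_fin_numE.
  have Df : mu D \is a fin_num by rewrite ge0_fin_numE.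
  rewrite addeACA -fin_num_oppeD// -nuCD -muCD.
  apply: mdiff_ub; first exact: measurableU.
  - exact: setUSS.
  - by rewrite muCD lte_add_pinfty.
have [AZ BZ] : mdiff A <= Z /\ mdiff B <= Z.
  by split; apply: le_mdiff => x; [left|right].
have [Aoo|Aoo] := eqVneq (mdiff A) +oo.
  by move: AZ; rewrite Aoo leye_eq => /eqP ->; rewrite leey.
have Af : mdiff A \is a fin_num by rewrite ge0_fin_numE// ltey.
rewrite addeC -leeBrDr//.
apply: ge_ereal_sup => _ [D [mD DB Doo] <-].
have Df : mu D \is a fin_num by rewrite ge0_fin_numE.
have [nuD|nuD] := eqVneq (nu D) +oo.
  have : nu D - mu D <= Z by apply: le_trans BZ; exact: mdiff_ub.
  rewrite nuD addye ?leye_eq; last by case: (mu D) Df.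
  by move=> /eqP ->; rewrite addye ?leey//; case: (mdiff A) Af.
have nuDf : nu D \is a fin_num by rewrite ge0_fin_numE// ltey.
rewrite leeBrDr// addeC -leeBrDr ?fin_numB ?nuDf//.
apply: ge_ereal_sup => _ [C [mC CA Coo] <-].
by rewrite leeBrDr ?fin_numB ?nuDf//; exact: step.
Qed.

Let mdiff_sigma_additive : semi_sigma_additive mdiff.
Proof.
move=> F mF tF mUF; apply: cvg_toP; first exact: is_cvg_ereal_nneg_natsum.
apply/eqP; rewrite eq_le; apply/andP; split.
  apply: lime_le; first exact: is_cvg_ereal_nneg_natsum.
  apply: nearW => N.
  apply: (@le_trans _ _ (mdiff (\big[setU/set0]_(0 <= i < N) F i))); last first.
    by apply: le_mdiff; rewrite big_mkord; exact: bigsetU_bigcup.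
  elim: N => [|N IH]; first by rewrite !big_geq.
  rewrite !big_nat_recr//=; apply: (le_trans (leeD2r _ IH)).
  apply: mdiff_superadd; rewrite big_mkord.
  apply: (@trivIset_bigsetUI _ predT) => //.
  by move=> i j _ _; apply: tF.
apply: ge_ereal_sup => _ [C [mC CF Coo] <-].
have Cf : mu C \is a fin_num by rewrite ge0_fin_numE.
have CE : C = \bigcup_i (C `&` F i).
  by rewrite -setI_bigcupr; apply/esym/setIidPl.
have mCF i : measurable (C `&` F i) by exact: measurableI.
have tCF : trivIset setT (fun i => C `&` F i) by exact: trivIset_setIl.
have mUC : measurable (\bigcup_i (C `&` F i)) by rewrite -CE.
have muE : mu C = \sum_(0 <= i <oo) mu (C `&` F i).
  by rewrite [in LHS]CE measure_semi_bigcup.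
have nuE : nu C = \sum_(0 <= i <oo) nu (C `&` F i).
  by rewrite [in LHS]CE measure_semi_bigcup.
rewrite leeBlDr// [X in _ + X]muE nuE -nneseriesD//.
apply: lee_nneseries => // i _.
have CFoo : mu (C `&` F i) < +oo.
  by apply: le_lt_trans Coo; apply: le_measure; rewrite ?inE//; exact: subIsetl.
rewrite -leeBlDr ?ge0_fin_numE//.
by apply: mdiff_ub => //; exact: subIsetr.
Qed.

HB.instance Definition _ := isMeasure.Build _ T R mdiff
  mdiff0 mdiff_ge0 mdiff_sigma_additive.

Lemma mdiffE (B : set T) : (forall C, measurable C -> mu C <= nu C) ->
  measurable B -> mu B < +oo -> nu B = mu B + mdiff B.
Proof.
move=> munu mB Boo; have Bf : mu B \is a fin_num by rewrite ge0_fin_numE.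
apply/eqP; rewrite eq_le; apply/andP; split.
  by rewrite addeC -leeBlDr//; exact: mdiff_ub.
rewrite addeC -leeBrDr//; apply: ge_ereal_sup => _ [C [mC CB Coo] <-].
have Cf : mu C \is a fin_num by rewrite ge0_fin_numE.
have mBC : measurable (B `\` C) by exact: measurableD.
have BCE : B = C `|` (B `\` C) by rewrite setDUK.
have D0 : C `&` (B `\` C) = set0 by rewrite setDIK.
have nuE : nu B = nu C + nu (B `\` C) by rewrite [in LHS]BCE measureU.
have muE : mu B = mu C + mu (B `\` C) by rewrite [in LHS]BCE measureU.
have BCf : mu (B `\` C) \is a fin_num.
  by move: Bf; rewrite muE fin_numD => /andP[].
rewrite leeBrDr// muE nuE addeA subeK//.
by apply: leeD2l; exact: munu.
Qed.

End measure_difference.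

(* The matrix library puts the max norm on 'rV[R]_n; it induces the usual
   topology, but the Riesz kernel needs the Euclidean norm. *)
Definition enorm (R : realType) (n : nat) (x : 'rV[R]_n) : R :=
  Num.sqrt (\sum_(k < n) x 0 k ^+ 2).

Definition Rn (R : realType) (n : nat) :=
  g_sigma_algebraType (@open 'rV[R]_n).

Definition bmeasure (R : realType) (n : nat) :=
  {measure set (Rn R n) -> \bar R}.

Section riesz.
Local Open Scope ereal_scope.
Variables (R : realType) (n : nat) (alpha : R).
Implicit Types (mu nu : bmeasure R n) (x y : 'rV[R]_n).

(* On R^n every Borel measure that is finite on compact sets is regular. *)
Definition radon mu : Prop := forall K : set 'rV[R]_n, compact K -> mu K < +oo.

Definition msupport mu : set 'rV[R]_n :=
  [set x | forall U : set 'rV[R]_n, open U -> U x -> 0 < mu U].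

Definition mle mu nu : Prop :=
  forall B : set (Rn R n), measurable B -> mu B <= nu B.

(* The diagonal is split off because [0 `^ r] is 0 for every r != 0, whereas
   |x - x|^(alpha - n) must be +oo for alpha < n. *)
Definition riesz x y : \bar R :=
  if x == y then +oo else (enorm (x - y) `^ (alpha - n%:R))%:E.

Definition potential mu x : \bar R := \int[mu]_y riesz x y.

Definition energy mu nu : \bar R := \int[mu]_x potential nu x.

(* Meant for Borel Q, so that [mu Q] makes sense.  The inverse of extended
   reals satisfies 0^-1 = +oo and +oo^-1 = 0, the latter covering the case
   where Q carries no unit measure of finite energy. *)
Definition capacity (Q : set 'rV[R]_n) : \bar R :=
  (ereal_inf [set energy mu mu | mu in
    [set mu : bmeasure R n |
      [/\ radon mu, mu.-negligible (~` Q), mu Q = 1 &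
          energy mu mu < +oo]]])^-1.

End riesz.

Section condenser.
Local Open Scope ereal_scope.
Variables (R : realType) (n : nat) (alpha : R) (I : finType).
Variables (A : I -> set 'rV[R]_n) (s : I -> R).

Definition plate_union (e : R) : set 'rV[R]_n :=
  \bigcup_(i in [set i | s i = e]) A i.

Definition touching : set 'rV[R]_n := plate_union 1 `&` plate_union (-1).

Definition condenser : Prop :=
  [/\ forall i, A i !=set0 /\ closed (A i),
      forall i, s i = 1%R \/ s i = (-1)%R,
      forall i, 0 < capacity alpha (A i) &
      capacity alpha touching = 0].

Definition vmeasures : set (I -> bmeasure R n) :=
  [set mu | forall i, radon (mu i) /\ msupport (mu i) `<=` A i].

Definition finite_energy : set (I -> bmeasure R n) :=
  [set mu | vmeasures mu /\ forall i, energy alpha (mu i) (mu i) < +oo].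

Definition venergy (mu : I -> bmeasure R n) : \bar R :=
  \sum_(i : I) \sum_(j : I) (s i * s j)%:E * energy alpha (mu i) (mu j).

Variable f : I -> 'rV[R]_n -> \bar R.

Definition case_I : Prop :=
  forall i, (forall x, 0 <= f i x) /\ lower_semicontinuous (f i).

Definition regular_part (i : I) : set 'rV[R]_n :=
  [set x | [/\ A i x, ~ touching x & `|f i x| < +oo]].

Definition gauss (mu : I -> bmeasure R n) : \bar R :=
  venergy mu + 2%:E * \sum_(i : I) \int[mu i]_x f i x.

Definition wpotential (mu : I -> bmeasure R n) (i : I) (x : 'rV[R]_n)
    : \bar R :=
  \sum_(j : I) (s i * s j)%:E * potential alpha (mu j) x + f i x.

Variables (a : I -> R) (g : I -> 'rV[R]_n -> R).

Definition constraints : set (I -> bmeasure R n) :=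
  [set sigma | vmeasures sigma /\
    forall i, (a i)%:E < \int[sigma i]_x (g i x)%:E /\
              msupport (sigma i) = A i].

Definition admissible (sigma : I -> bmeasure R n) : set (I -> bmeasure R n) :=
  [set mu | [/\ finite_energy mu, gauss mu \is a fin_num,
    forall i, mle (mu i) (sigma i) &
    forall i, \int[mu i]_x (g i x)%:E = (a i)%:E]].

Definition solutions (sigma : I -> bmeasure R n) : set (I -> bmeasure R n) :=
  [set lambda | admissible sigma lambda /\
    gauss lambda = ereal_inf [set gauss mu | mu in admissible sigma]].

End condenser.

(* Main.v *)
(* The Gauss functional G is a quadratic functional whose derivative at lambda in
   the direction mu - lambda is 2 sum_i \int W^i d(mu^i - lambda^i).  It is convex
   because the Riesz kernel is positive definite: |x - y|^(alpha - n) is a mixture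
   of the Gaussians exp(-t |x - y|^2), and each of these is, up to the factor
   exp(-t |x|^2) exp(-t |y|^2), a series in the powers of the dot product with
   nonnegative coefficients.  Hence lambda is a minimizer iff
   \int W^i dmu^i >= \int W^i dlambda^i for every admissible exchange of mass in
   the i-th component.  The inequalities of (ii) give this at once: W^i - w^i g_i
   can only be negative where lambda^i = sigma^i, and only positive off the support
   of lambda^i.  Conversely, if W^i / g_i were larger on some mass of lambda^i than
   on some mass of sigma^i - lambda^i, trading a little of the former for the
   latter would decrease G; so a threshold w^i exists, first up to null sets.  The
   second inequality extends to the whole support since W^i is lower
   semicontinuous: as kappa_alpha(., sigma^j) is continuous on A_j and
   lambda^j <= sigma^j, the potential of lambda^j is continuous on R^n. *)
Require Import Defs.
From HB Require Import structures.
From mathcomp Require Import all_boot all_order all_algebra.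
From mathcomp Require Import all_classical all_reals all_analysis.
From mathcomp Require Import measurable_realfun ring lra.
Set Implicit Arguments.
Unset Strict Implicit.
Unset Printing Implicit Defensive.
Import Order.TTheory GRing.Theory Num.Theory.
Import numFieldNormedType.Exports.
Local Open Scope classical_set_scope.
Local Open Scope ring_scope.

(** * Stretched exponentials *)

(** Two obstacles shape the development. Signed measures such as mu - lambda are never formed:
    positivity is stated for finite families of positive measures with real weights. For each single
    Gaussian, positivity with the weights 1 and -1 is also what makes mutual Riesz energies finite,
    without which the signed double sum of the energy could not be handled. Moreover sigma^i may
    have infinite mass, energy and field integral, whereas lambda^i is finite because g_i is bounded
    below and has lambda^i-integral a_i; mass taken from sigma^i - lambda^i must therefore be cut
    down to a piece where all three are finite. The potential of lambda^j is continuous on A_j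
    because it and the potential of sigma^j - lambda^j are both lower semicontinuous and have a
    continuous sum; comparison with almost nearest points of A_j carries this over to R^n. These
    potentials being real everywhere, W^i can be infinite only through f_i. *)

Section laplace.
Context {R : realType}.
Local Notation leb := (@lebesgue_measure R).
Variable p : R.
Hypothesis p0 : 0 < p.

(** In the Gamma integral of [t^(r-1) exp(-t u)] the substitution [t = v^(1/r)] absorbs the density;
    with [p = 1/r] this leaves a stretched exponential integrated against plain Lebesgue measure. *)
Definition stretched (v : R) : R := expR (- (v `^ p)).

Lemma stretched_ge0 v : 0 <= stretched v.
Proof. exact: expR_ge0. Qed.

Lemma stretched_continuous : {within `[0, +oo[, continuous stretched}.
Proof.
apply/continuous_within_itvcyP; split.
  move=> x; rewrite in_itv/= andbT => x0.
  apply: continuous_comp; last exact: continuous_expR.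
  apply: continuousN; apply: differentiable_continuous.
  by apply/derivable1_diffP; apply: derivable_powR; rewrite in_itv/= andbT.
apply: (@cvg_comp _ _ _ (fun v => - (v `^ p)) (@expR R) _ (nbhs (- (0 `^ p)))).
  apply: cvgN; rewrite powR0 ?gt_eqF//; exact: powR_cvg0.
exact: continuous_expR.
Qed.

Lemma measurable_stretched : measurable_fun setT stretched.
Proof.
apply: measurableT_comp => //; apply: measurableT_comp => //.
Qed.

(** This is [Gamma(1 + 1/p)]; what matters below is that it is positive and finite. *)
Definition stretched_mass : \bar R :=
  (\int[leb]_(v in `[0%R, +oo[) (stretched v)%:E)%E.

Lemma stretched_mass_lty : (stretched_mass < +oo)%E.
Proof.
(* Chosen so that [p m >= 2]: for [v > 1] then [v^2 <= (v^p)^m <= m! exp(v^p)], which yields a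
   majorant of the form [C / (1 + v^2)]. *)
pose m := (Num.truncn (2 / p)).+1.
have pm2 : 2 <= p * m%:R.
  rewrite mulrC -ler_pdivrMr//; exact/ltW/truncnS_gt.
have B v : 0 <= v -> stretched v <= (2 + m`!%:R) * (oneDsqr v)^-1.
  move=> v0.
  rewrite /stretched expRN ler_pdivlMr ?(lt_le_trans _ (oneDsqr_ge1 _))//.
  rewrite ler_pdivrMl ?expR_gt0//.
  have h1 : 1 <= expR (v `^ p) by rewrite -[leLHS]expR0 ler_expR powR_ge0.
  have [v1|v1] := leP v 1.
    have h2 : oneDsqr v <= 2.
      by rewrite /oneDsqr -[2]/(1 + 1) lerD2l expr_le1.
    apply: le_trans h2 _; have : 0 <= m`!%:R :> R by [].
    nra.
  have h3 := expR_ge1Dxn m.-1 (powR_ge0 v p).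
  have f0 : 0 < m`!%:R :> R by rewrite ltr0n fact_gt0.
  have h4 : v ^+ 2 <= (v `^ p) ^+ m.
    by rewrite -!powR_mulrn ?powR_ge0// -powRrM ler_powR// ltW.
  have h5 : (v `^ p) ^+ m <= m`!%:R * expR (v `^ p).
    rewrite mulrC -ler_pdivrMr//; apply: le_trans h3.
    by rewrite prednK// lerDr.
  by rewrite /oneDsqr; nra.
apply: (@le_lt_trans _ _ (\int[leb]_(v in `[0%R, +oo[)
     ((2 + m`!%:R)%:E * ((oneDsqr v)^-1)%:E))%E).
  apply: ge0_le_integral => //.
  - by move=> v _; rewrite lee_fin stretched_ge0.
  - apply/measurable_EFinP; apply: measurable_funTS; exact: measurable_stretched.
  - apply/measurable_EFinP; apply: measurable_funM => //; apply: measurable_funTS.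
    by apply: continuous_measurable_fun; exact: continuous_oneDsqrV.
  - move=> v /=; rewrite in_itv/= andbT => v0.
    by rewrite -EFinM lee_fin B.
rewrite ge0_integralZl//.
- by rewrite integral0y_oneDsqr -EFinM ltry.
- apply/measurable_EFinP; apply: measurable_funTS.
  by apply: continuous_measurable_fun; exact: continuous_oneDsqrV.
Qed.

Lemma stretched_mass_gt0 : (0 < stretched_mass)%E.
Proof.
apply: (@lt_le_trans _ _ (\int[leb]_(v in `[0%R, 1%R]) (expR (- 1))%:E)%E).
  rewrite integral_cst//= lebesgue_measure_itv/= lte_fin ltr01 -EFinD subr0 mule1.
  by rewrite lte_fin expR_gt0.
apply: (@le_trans _ _ (\int[leb]_(v in `[0%R, 1%R]) (stretched v)%:E)%E).
  apply: ge0_le_integral => //.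
  - apply/measurable_EFinP; apply: measurable_funTS; exact: measurable_stretched.
  - move=> v /=; rewrite in_itv/= => /andP[v0 v1].
    have e1 : 1 `^ p = 1 :> R by rewrite powR1.
    by rewrite lee_fin ler_expR lerN2 -[leRHS]e1 ge0_ler_powR ?nnegrE// ltW.
apply: ge0_subset_integral => //.
- apply/measurable_EFinP; apply: measurable_funTS; exact: measurable_stretched.
- by move=> v _; rewrite lee_fin stretched_ge0.
- by apply: subset_itvl.
Qed.

Lemma stretched_scaling (c : R) : 0 < c ->
  (stretched_mass = c%:E * \int[leb]_(v in `[0%R, +oo[) (stretched (v * c))%:E)%E.
Proof.
move=> c0; pose F (v : R) := v * c.
have dF : (F^`())%classic = cst c.
  by apply/funext => z; rewrite derive1Mr// derive1_id mul1r.
have cF : continuous F by move=> x; apply: cvgM => //; exact: cvg_cst.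
have := @increasing_ge0_integration_by_substitutiony R F stretched 0.
have F0 : F 0 = 0 by rewrite /F mul0r.
rewrite F0 /stretched_mass => ->.
- rewrite dF -ge0_integralZl//.
  + by apply: eq_integral => v _; rewrite /= /F -EFinM mulrC.
  + apply/measurable_EFinP; apply: measurable_funTS.
    apply: (measurableT_comp measurable_stretched).
    by apply: measurable_funM.
  + by move=> v _; rewrite lee_fin stretched_ge0.
  + by rewrite lee_fin ltW.
- by move=> x y _ _ xy; rewrite ltr_pM2r.
- by rewrite dF => z _; exact: cvg_cst.
- by rewrite dF; exact: is_cvg_cst.
- by rewrite dF; exact: is_cvg_cst.
- split; last by apply: cvg_at_right_filter; exact: cF.
  by move=> x _; apply: derivableM => //.
- by apply: gt0_cvgMly => //; exact: cvg_id.
- exact: stretched_continuous.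
- by move=> x _; exact: stretched_ge0.
Qed.

End laplace.

(** * The squared Euclidean norm and the Riesz kernel *)

Lemma cvg_sumr {R : realType} (T J : Type) (F : set_system T) {FF : Filter F}
    (r : seq J) (f : J -> T -> R) (l : J -> R) :
  (forall j, f j t @[t --> F] --> l j) ->
  \sum_(j <- r) f j t @[t --> F] --> \sum_(j <- r) l j.
Proof.
move=> fl; elim: r => [|j r IH].
  by rewrite big_nil; under eq_fun do rewrite big_nil; exact: cvg_cst.
by rewrite big_cons; under eq_fun do rewrite big_cons; exact: cvgD.
Qed.

Section sqn.
Context {R : realType} {n : nat}.
Implicit Types x y z : 'rV[R]_n.

(** The square of [enorm]. Coordinates enter polynomially, and the triangle inequality survives with
    a factor 2, see [sqn_sub_le]. *)
Definition sqn x : R := \sum_(k < n) x 0 k ^+ 2.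

Lemma sqn_ge0 x : 0 <= sqn x.
Proof. by apply: sumr_ge0 => k _; exact: sqr_ge0. Qed.

Lemma sqn_eq0 x : (sqn x == 0) = (x == 0).
Proof.
apply/idP/eqP => [|->]; last first.
  by apply/eqP; apply: big1 => k _; rewrite mxE expr0n.
rewrite psumr_eq0; last by move=> k _; exact: sqr_ge0.
move=> /allP h; apply/rowP => k; rewrite mxE; apply/eqP.
by rewrite -sqrf_eq0; apply: (implyP (h k (mem_index_enum k))).
Qed.

Lemma sqn0 : sqn 0 = 0.
Proof. by apply/eqP; rewrite sqn_eq0. Qed.

Lemma sqnB_eq0 x y : (sqn (x - y) == 0) = (x == y).
Proof. by rewrite sqn_eq0 subr_eq0. Qed.

Lemma sqnN x : sqn (- x) = sqn x.
Proof. by apply: eq_bigr => k _; rewrite mxE sqrrN. Qed.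

Lemma sqnBC x y : sqn (x - y) = sqn (y - x).
Proof. by rewrite -sqnN opprB. Qed.

Lemma sqnD x y : sqn (x + y) <= 2 * sqn x + 2 * sqn y.
Proof.
rewrite !mulr_sumr -big_split /=; apply: ler_sum => k _.
by rewrite mxE; have := sqr_ge0 (x 0 k - y 0 k); nra.
Qed.

Lemma sqn_sub_le x y z : sqn (x - z) <= 2 * sqn (x - y) + 2 * sqn (y - z).
Proof. by have := sqnD (x - y) (y - z); rewrite addrA subrK. Qed.

Lemma coord_sqr_le_sqn x k : x 0 k ^+ 2 <= sqn x.
Proof.
by rewrite /sqn (bigD1 k)//= lerDl; apply: sumr_ge0 => i _; exact: sqr_ge0.
Qed.

Lemma sqn_cvg (T : Type) (F : set_system T) {FF : Filter F}
    (u : T -> 'rV[R]_n) x y :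
  u t @[t --> F] --> x -> sqn (u t - y) @[t --> F] --> sqn (x - y).
Proof.
move=> ux; rewrite /sqn.
apply: (@cvg_sumr _ _ _ _ _ _ (fun k t => (u t - y) 0 k ^+ 2)) => k.
have h : (u t - y) 0 k @[t --> F] --> (x - y) 0 k.
  rewrite !mxE; under eq_fun do rewrite !mxE.
  apply: cvgB; last exact: cvg_cst.
  exact: (cvg_comp _ _ ux (@coord_continuous R 1 n 0 k x)).
by rewrite expr2; under eq_fun do rewrite expr2; exact: cvgM.
Qed.

Lemma cvg_sqn (T : Type) (F : set_system T) {FF : Filter F}
    (u : T -> 'rV[R]_n) x :
  sqn (u t - x) @[t --> F] --> 0 -> u t @[t --> F] --> x.
Proof.
move=> /cvgrPdist_lt h; apply/cvg_ballP => e e0.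
have e20 : 0 < e ^+ 2 by rewrite exprn_gt0.
have := h _ e20; apply: filterS => t.
rewrite sub0r normrN ger0_norm ?sqn_ge0// => ht.
split => // i k; rewrite (ord1 i) /ball/=.
rewrite -(ltr_pXn2r (_ : (0 < 2)%N))// ?nnegrE//; last exact: ltW.
rewrite real_normK ?num_real//; apply: le_lt_trans ht.
by rewrite -sqnN; apply: le_trans (coord_sqr_le_sqn _ k); rewrite !mxE opprB.
Qed.

Definition dotr x y : R := \sum_(k < n) x 0 k * y 0 k.

Lemma sqnB x y : sqn (x - y) = sqn x + sqn y - 2 * dotr x y.
Proof.
rewrite /sqn /dotr mulr_sumr -sumrN -!big_split /=; apply: eq_bigr => k _.
by rewrite !mxE; ring.
Qed.

Lemma dotr_le x y : 2 * `|dotr x y| <= sqn x + sqn y.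
Proof.
have [h|h] := leP 0 (dotr x y).
  by rewrite ger0_norm//; have := sqn_ge0 (x - y); rewrite sqnB; lra.
rewrite ltr0_norm//; have := sqn_ge0 (x - - y).
by rewrite sqnB sqnN /dotr; under eq_bigr do rewrite mxE mulrN;
  rewrite sumrN -/(dotr x y); lra.
Qed.

End sqn.

Section borel.
Context {R : realType} {n : nat}.

Lemma open_Rn_measurable (U : set 'rV[R]_n) :
  open U -> measurable (U : set (Rn R n)).
Proof. by move=> oU; apply: sub_sigma_algebra. Qed.

Lemma closed_Rn_measurable (U : set 'rV[R]_n) :
  closed U -> measurable (U : set (Rn R n)).
Proof.
move=> cU; rewrite -[U]setCK; apply: measurableC.
by apply: open_Rn_measurable; exact: closed_openC.
Qed.

Lemma continuous_Rn_measurable (h : 'rV[R]_n -> R) :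
  continuous h -> measurable_fun setT (h : Rn R n -> R).
Proof.
move=> ch; apply: (measurability _ (RGenOInfty.measurableE R)).
move=> /= _ [_ [c ->] <-]; rewrite setTI; apply: open_Rn_measurable.
by apply: open_comp => [x _|]; [exact: ch|exact: interval_open].
Qed.

Lemma lsc_Rn_measurable (h : 'rV[R]_n -> \bar R) :
  lower_semicontinuous h -> measurable_fun setT (h : Rn R n -> \bar R).
Proof.
move=> lh; apply: (measurability _ (ErealGenOInfty.measurableE R)).
move=> /= _ [_ [c ->]] <-; apply: measurableI => //; apply: open_Rn_measurable.
by rewrite preimage_itvoy; move/lower_semicontinuousP : lh; exact.
Qed.

Lemma measurable_coord (k : 'I_n) :
  measurable_fun setT (fun x : Rn R n => (x : 'rV[R]_n) 0 k).
Proof. by apply: continuous_Rn_measurable; exact: coord_continuous. Qed.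

Lemma measurable_sqn : measurable_fun setT (sqn : Rn R n -> R).
Proof.
apply: measurable_sum => k; apply: measurable_funX; exact: measurable_coord.
Qed.

(** Measurability is for the product of two Borel sigma-algebras, so it is reduced to the
    coordinates rather than deduced from continuity. *)
Lemma measurable_sqnB :
  measurable_fun setT
    (fun z : Rn R n * Rn R n => sqn ((z.1 : 'rV[R]_n) - z.2)).
Proof.
apply: measurable_sum => k; apply: measurable_funX.
under eq_fun do rewrite !mxE.
by apply: measurable_funB;
  [exact: (measurableT_comp (measurable_coord k) measurable_fst)
  |exact: (measurableT_comp (measurable_coord k) measurable_snd)].
Qed.

Lemma measurable_dotr :
  measurable_fun setT
    (fun z : Rn R n * Rn R n => dotr (z.1 : 'rV[R]_n) z.2).
Proof.
apply: measurable_sum => k; apply: measurable_funM;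
  [exact: (measurableT_comp (measurable_coord k) measurable_fst)
  |exact: (measurableT_comp (measurable_coord k) measurable_snd)].
Qed.

End borel.

Section riesz_kernel.
Context {R : realType} (n : nat) (alpha : R).
Hypothesis alpha_ltn : alpha < n%:R.
Implicit Types x y : 'rV[R]_n.

(** Half the exponent, so that [|x - y|^(alpha - n) = (|x - y|^2)^(- riesz_exp)]. *)
Definition riesz_exp : R := (n%:R - alpha) / 2.

Lemma riesz_exp_gt0 : 0 < riesz_exp.
Proof. by rewrite /riesz_exp divr_gt0// subr_gt0. Qed.

(** The kernel as a function of the squared distance. The value [+oo] at 0 makes it continuous and
    nonincreasing on the closed half-line. *)
Definition rprofile (u : R) : \bar R :=
  if u == 0 then +oo%E else (u `^ (- riesz_exp))%:E.

Lemma rieszE x y : riesz alpha x y = rprofile (sqn (x - y)).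
Proof.
rewrite /riesz /rprofile sqnB_eq0; case: eqP => // _; congr (_ %:E).
rewrite /enorm -/(sqn (x - y)) -powR12_sqrt ?sqn_ge0// -powRrM; congr (_ `^ _).
by rewrite /riesz_exp; lra.
Qed.

Lemma rprofile_ge0 u : (0 <= rprofile u)%E.
Proof. by rewrite /rprofile; case: ifP => // _; rewrite lee_fin powR_ge0. Qed.

Lemma riesz_ge0 x y : (0 <= riesz alpha x y)%E.
Proof. by rewrite rieszE rprofile_ge0. Qed.

Lemma rieszC x y : riesz alpha x y = riesz alpha y x.
Proof. by rewrite !rieszE sqnBC. Qed.

Lemma measurable_rprofile : measurable_fun setT rprofile.
Proof.
apply: measurable_fun_if => //=.
- apply: (measurable_fun_bool true) => /=; rewrite setTI.
  rewrite (_ : _ @^-1` _ = [set 0]); first exact: measurable_set1.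
  by apply/seteqP; split => u /=; [move/eqP|move=> ->; rewrite eqxx].
- apply/measurable_EFinP; apply: measurable_funTS; exact: measurable_powR.
Qed.

Lemma measurable_riesz2 : measurable_fun setT
  (fun z : Rn R n * Rn R n => riesz alpha (z.1 : 'rV[R]_n) z.2).
Proof.
under eq_fun do rewrite rieszE.
exact: (measurableT_comp measurable_rprofile measurable_sqnB).
Qed.

Lemma measurable_riesz x :
  measurable_fun setT (fun y : Rn R n => riesz alpha x y).
Proof.
exact: (measurableT_comp measurable_riesz2 (measurable_pair1 (x : Rn R n))).
Qed.

Lemma rprofile_continuous (u : R) : 0 <= u -> forall v : nat -> R, (forall k, 0 <= v k) ->
  v k @[k --> \oo] --> u -> rprofile (v k) @[k --> \oo] --> rprofile u.
Proof.
move=> u0 v v0 vu; rewrite {2}/rprofile; case: eqP => [u_eq0|/eqP u_neq0].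
  apply/cvgeyPge => M.
  (* Solves [d^(- riesz_exp) = max(M, 1)]; the maximum with 1 keeps the base positive. *)
  pose d := (Num.max M 1) `^ (- riesz_exp^-1).
  have M0 : 0 < Num.max M 1 by rewrite lt_max ltr01 orbT.
  have d0 : 0 < d by rewrite powR_gt0.
  have := vu; rewrite u_eq0 => /cvgrPdist_lt /(_ _ d0); apply: filterS => k.
  rewrite sub0r normrN ger0_norm// => vd; rewrite /rprofile; case: ifPn.
    by rewrite leey.
  move=> vk0; rewrite lee_fin (@le_trans _ _ (Num.max M 1))//.
    by rewrite le_max lexx.
  have -> : Num.max M 1 = d `^ (- riesz_exp).
    rewrite /d -powRrM mulrNN mulVf ?gt_eqF ?riesz_exp_gt0//.
    by rewrite powRr1// ltW.
  have vk1 : 0 < v k by rewrite lt_neqAle eq_sym vk0 v0.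
  rewrite !powRN lef_pV2 ?posrE ?powR_gt0//.
  by rewrite ge0_ler_powR ?nnegrE// ?ltW// riesz_exp_gt0.
have up : 0 < u by rewrite lt_neqAle eq_sym u_neq0.
have h : (v k) `^ (- riesz_exp) @[k --> \oo] --> u `^ (- riesz_exp).
  have c : {for u, continuous (fun w : R => w `^ (- riesz_exp))}.
    apply: differentiable_continuous; apply/derivable1_diffP.
    by apply: derivable_powR; rewrite in_itv/= andbT.
  exact: (@cvg_comp _ _ _ v (fun w => w `^ (- riesz_exp)) _ _ _ vu c).
apply: cvg_trans (_ : ((v k) `^ (- riesz_exp))%:E @[k --> \oo] --> _);
  last by apply/fine_cvgP; split => //; exact: nearW.
apply: near_eq_cvg.
have := vu => /cvgrPdist_lt /(_ _ up); apply: filterS => k huk /=.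
rewrite /rprofile; case: eqP => // vk0.
by move: huk; rewrite vk0 subr0 gtr0_norm// ltxx.
Qed.

Lemma riesz_cvg (u : nat -> 'rV[R]_n) x y :
  u k @[k --> \oo] --> x ->
  riesz alpha (u k) y @[k --> \oo] --> riesz alpha x y.
Proof.
move=> ux; rewrite rieszE; under eq_fun do rewrite rieszE.
apply: rprofile_continuous => //; [exact: sqn_ge0|move=> k; exact: sqn_ge0|].
exact: sqn_cvg.
Qed.

Lemma rprofile_anti u v : 0 <= u -> u <= v -> (rprofile v <= rprofile u)%E.
Proof.
move=> u0 uv; rewrite /rprofile; case: (eqVneq u 0) => [_|un]; first exact: leey.
have up : 0 < u by rewrite lt_neqAle eq_sym un.
have vp : 0 < v by exact: lt_le_trans uv.
rewrite gt_eqF// lee_fin !powRN lef_pV2 ?posrE ?powR_gt0//.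
by rewrite ge0_ler_powR ?nnegrE// ?ltW// riesz_exp_gt0.
Qed.

Lemma rprofileM c u : 0 < c -> 0 <= u ->
  (rprofile (c * u) = (c `^ (- riesz_exp))%:E * rprofile u)%E.
Proof.
move=> c0 u0; rewrite /rprofile mulf_eq0 gt_eqF//=; case: eqP => _.
  by rewrite gt0_muley// lte_fin powR_gt0.
by rewrite -EFinM powRM// ltW.
Qed.

End riesz_kernel.

(** * Positive definiteness *)

Section bounded_measurable.
Context d (T : measurableType d) (R : realType).
Implicit Types F G : T -> R.

(** Such functions are integrable for every finite measure and closed under sums and products, so
    the quadratic form below is linear on them without further integrability conditions. *)
Definition bmeas F := measurable_fun setT F /\ exists B, forall x, `|F x| <= B.

Lemma bmeas_cst k : bmeas (fun=> k).
Proof. by split; [exact: measurable_cst|exists `|k|]. Qed.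

Lemma bmeasD F G : bmeas F -> bmeas G -> bmeas (fun x => F x + G x).
Proof.
move=> [mF [B FB]] [mG [C GC]]; split; first exact: measurable_funD.
by exists (B + C) => x; rewrite (le_trans (ler_normD _ _))// lerD.
Qed.

Lemma bmeasM F G : bmeas F -> bmeas G -> bmeas (fun x => F x * G x).
Proof.
move=> [mF [B FB]] [mG [C GC]]; split; first exact: measurable_funM.
by exists (B * C) => x; rewrite normrM ler_pM.
Qed.

Lemma bmeas_sum (J : Type) (r : seq J) (H : J -> T -> R) :
  (forall j, bmeas (H j)) -> bmeas (fun x => \sum_(j <- r) H j x).
Proof.
move=> bH; elim: r => [|j r IH].
  by under eq_fun do rewrite big_nil; exact: bmeas_cst.
by under eq_fun do rewrite big_cons; exact: bmeasD.
Qed.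

Lemma bmeas_integrable (mu : {measure set T -> \bar R}) F :
  (mu setT < +oo)%E -> bmeas F -> mu.-integrable setT (EFin \o F).
Proof.
move=> muT [mF [B FB]]; apply: measurable_bounded_integrable => //.
exists B; split; first exact: num_real.
by move=> C BC x _; exact: le_trans (FB x) (ltW BC).
Qed.

End bounded_measurable.

Section bounded_measurable_prod.
Context d (T : measurableType d) (R : realType).

Lemma bmeas_tensor (f g : T -> R) :
  bmeas f -> bmeas g -> bmeas (fun z : T * T => f z.1 * g z.2).
Proof.
move=> [mf [B fB]] [mg [C gC]]; apply: bmeasM; split.
- exact: (measurableT_comp mf measurable_fst).
- by exists B.
- exact: (measurableT_comp mg measurable_snd).
- by exists C.
Qed.

Variables m1 m2 : {finite_measure set T -> \bar R}.

Lemma finite_prod_lty : ((m1 \x m2) setT < +oo)%E.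
Proof.
rewrite -setXTT [ltLHS]product_measure1E// lte_mul_pinfty//.
- by rewrite fin_num_measure.
- by rewrite -ge0_fin_numE// fin_num_measure.
Qed.

(* The library's finite and sigma-finite instances on [m1 \x m2] are keyed on
   subprobabilities only, hence this alias. *)
Definition finite_prod : set (T * T) -> \bar R := (m1 \x m2)%E.

HB.instance Definition _ := Measure.on finite_prod.

Let finite_prod_fin : fin_num_fun finite_prod.
Proof.
move=> A mA; rewrite ge0_fin_numE//; apply: le_lt_trans finite_prod_lty.
by apply: le_measure; rewrite ?inE.
Qed.

HB.instance Definition _ := Measure_isFinite.Build _ _ _ finite_prod
  finite_prod_fin.

Lemma Rintegral_tensor (f g : T -> R) : bmeas f -> bmeas g ->
  \int[(m1 \x m2)%E]_z (f z.1 * g z.2) = (\int[m1]_x f x) * (\int[m2]_y g y).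
Proof.
move=> bf bg.
have fin m : (m : {finite_measure set T -> \bar R}) setT \is a fin_num.
  exact: fin_num_measure.
have if_ : m1.-integrable setT (EFin \o f).
  by apply: bmeas_integrable => //; rewrite -ge0_fin_numE//; exact: fin.
have ig : m2.-integrable setT (EFin \o g).
  by apply: bmeas_integrable => //; rewrite -ge0_fin_numE//; exact: fin.
have h := @integral12_prod_meas1 _ _ _ _ R m1 m2
  (fun z => (f z.1 * g z.2)%:E) (bmeas_integrable finite_prod_lty (bmeas_tensor bf bg)).
rewrite /Rintegral -h /fubini_F.
have Eg : ((\int[m2]_y g y)%:E = \int[m2]_y (g y)%:E)%E.
  by rewrite fineK//; exact: integrable_fin_num.
transitivity (fine (\int[m1]_x ((f x)%:E * (\int[m2]_y g y)%:E))%E).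
  congr fine; apply: eq_integral => x _; rewrite Eg -integralZl//.
by rewrite integralZr// fineM//; exact: integrable_fin_num.
Qed.

Variables (d' : measure_display) (U : measurableType d')
  (mu : {sigma_finite_measure set U -> \bar R}).
Variable F : (T * T) * U -> \bar R.
Hypotheses (mF : measurable_fun setT F) (F0 : forall w, (0 <= F w)%E).

Lemma measurable_prod_param :
  (measurable_fun setT (fun v => \int[m1 \x m2]_z F (z, v)))%E.
Proof.
exact: (@measurable_fun_fubini_tonelli_G _ _ _ _ _
  [the {finite_measure set (T * T)%type -> \bar R} of finite_prod] F mF F0).
Qed.

Lemma prod_param_tonelli :
  (\int[m1 \x m2]_z \int[mu]_v F (z, v) =
   \int[mu]_v \int[m1 \x m2]_z F (z, v))%E.
Proof.
exact: (@fubini_tonelli _ _ _ _ _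
  [the {finite_measure set (T * T)%type -> \bar R} of finite_prod] mu F mF F0).
Qed.

End bounded_measurable_prod.

Section quadratic_form.
Context d (T : measurableType d) (R : realType) (J : finType).
Variables (c : J -> R) (m : J -> {finite_measure set T -> \bar R}).
Implicit Types F G : T * T -> R.

(** The double integral of [F] against the signed measure [\sum_p c p m p] in both variables,
    expanded over pairs so that only positive measures are integrated against. *)
Definition qform F : R :=
  \sum_(p : J) \sum_(q : J) c p * c q * \int[(m p \x m q)%E]_z F z.

Lemma qform0 : qform (fun=> 0) = 0.
Proof.
apply: big1 => p _; apply: big1 => q _.
by rewrite Rintegral_cst// mul0r mulr0.
Qed.

Lemma qformD F G : bmeas F -> bmeas G ->
  qform (fun z => F z + G z) = qform F + qform G.
Proof.
move=> bF bG; rewrite /qform -big_split/=; apply: eq_bigr => p _.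
rewrite -big_split/=; apply: eq_bigr => q _.
rewrite RintegralD//; first by rewrite mulrDr.
- by apply: bmeas_integrable => //; exact: finite_prod_lty.
- by apply: bmeas_integrable => //; exact: finite_prod_lty.
Qed.

Lemma qformZ k F : bmeas F -> qform (fun z => k * F z) = k * qform F.
Proof.
move=> bF; rewrite /qform mulr_sumr; apply: eq_bigr => p _.
rewrite mulr_sumr; apply: eq_bigr => q _.
rewrite RintegralZl//; first by rewrite mulrCA.
by apply: bmeas_integrable => //; exact: finite_prod_lty.
Qed.

Lemma qform_sum (K : Type) (r : seq K) (H : K -> T * T -> R) :
  (forall k, bmeas (H k)) ->
  qform (fun z => \sum_(k <- r) H k z) = \sum_(k <- r) qform (H k).
Proof.
move=> bH; elim: r => [|k r IH].
  by rewrite big_nil -[RHS]qform0; congr qform; apply/funext => z; rewrite big_nil.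
rewrite big_cons -IH -qformD//; last exact: bmeas_sum.
by congr qform; apply/funext => z; rewrite big_cons.
Qed.

Lemma qform_tensor (f : T -> R) : bmeas f -> 0 <= qform (fun z => f z.1 * f z.2).
Proof.
move=> bf; suff -> : qform (fun z => f z.1 * f z.2) =
    (\sum_p c p * \int[m p]_x f x) ^+ 2 by exact: sqr_ge0.
rewrite expr2 mulr_suml; apply: eq_bigr => p _; rewrite mulr_sumr.
by apply: eq_bigr => q _; rewrite Rintegral_tensor// mulrACA.
Qed.

(** Dominated convergence with the constant [B], integrable because the product measures are
    finite. *)
Lemma qform_cvg_ge0 (H : nat -> T * T -> R) F (B : R) :
  (forall k, measurable_fun setT (H k)) -> measurable_fun setT F ->
  (forall k z, `|H k z| <= B) ->
  (forall z, H k z @[k --> \oo] --> F z) ->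
  (forall k, 0 <= qform (H k)) -> 0 <= qform F.
Proof.
move=> mH mF HB HF H0.
have cvg1 p q : \int[(m p \x m q)%E]_z H k z @[k --> \oo] -->
    \int[(m p \x m q)%E]_z F z.
  have [] := @dominated_convergence _ _ R (m p \x m q)%E setT measurableT
    (fun k z => (H k z)%:E) (fun z => (F z)%:E) (fun=> B%:E).
  - by move=> k; exact/measurable_EFinP.
  - exact/measurable_EFinP.
  - apply: aeW => z _; apply/fine_cvgP; split; first exact: nearW.
    exact: HF.
  - by apply: bmeas_integrable; [exact: finite_prod_lty|exact: bmeas_cst].
  - by apply: aeW => z k _; rewrite lee_fin.
  move=> iF _ h.
  apply: fine_cvg; rewrite /Rintegral fineK//.
  by have := integrable_fin_num measurableT iF.
have : qform (H k) @[k --> \oo] --> qform F.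
  apply: (@cvg_sumr _ _ _ _ _ _
    (fun p k => \sum_q c p * c q * \int[(m p \x m q)%E]_z H k z)) => p.
  apply: (@cvg_sumr _ _ _ _ _ _
    (fun q k => c p * c q * \int[(m p \x m q)%E]_z H k z)) => q.
  by apply: cvgM; [exact: cvg_cst|exact: cvg1].
by move=> h; rewrite -(cvg_lim _ h)//; apply: limr_ge;
  [apply/cvg_ex; eexists; exact: h|exact: nearW].
Qed.

End quadratic_form.

Section gaussian_form.
Context (R : realType) (n : nat) (J : finType).
Variables (c : J -> R) (m : J -> {finite_measure set (Rn R n) -> \bar R}).

Lemma dotr_sqr_le (x y : 'rV[R]_n) : dotr x y ^+ 2 <= sqn x * sqn y.
Proof.
have [x0|x0] := eqVneq (sqn x) 0.
  have -> : x = 0 by apply/eqP; rewrite -sqn_eq0 x0.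
  rewrite (_ : dotr 0 y = 0) ?expr0n ?mulr_ge0 ?sqn_ge0//.
  by apply: big1 => k _; rewrite mxE mul0r.
have xp : 0 < sqn x by rewrite lt_neqAle eq_sym x0 sqn_ge0.
(* This squared norm expands to [sqn x] times the Cauchy-Schwarz defect
   [sqn x * sqn y - dotr x y ^+ 2]. *)
have h := sqn_ge0 (dotr x y *: x - sqn x *: y).
have e1 a z : sqn (a *: z) = a ^+ 2 * sqn z :> R.
  by rewrite mulr_sumr; apply: eq_bigr => k _; rewrite mxE exprMn.
have e2 a b : dotr (a *: x) (b *: y) = a * b * dotr x y.
  by rewrite mulr_sumr; apply: eq_bigr => k _; rewrite !mxE; ring.
rewrite sqnB !e1 e2 in h.
rewrite -(ler_pM2l xp); nra.
Qed.

(** By Cauchy-Schwarz the square of the kernel is at most the product of [phi^2 |.|^(2k)] at the two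
    points, hence at most [B^2]. *)
Lemma bmeas_weighted_dotr k (phi : Rn R n -> R) B :
  measurable_fun setT phi -> (forall x, phi x ^+ 2 * sqn x ^+ k <= B) ->
  bmeas (fun z : Rn R n * Rn R n => phi z.1 * phi z.2 * dotr z.1 z.2 ^+ k).
Proof.
move=> mphi hB; split.
  apply: measurable_funM; last by apply: measurable_funX; exact: measurable_dotr.
  by apply: measurable_funM;
    [exact: (measurableT_comp mphi measurable_fst)
    |exact: (measurableT_comp mphi measurable_snd)].
have B0 : 0 <= B.
  by apply: le_trans (hB 0); rewrite mulr_ge0 ?sqr_ge0// exprn_ge0// sqn_ge0.
exists B => -[x y] /=.
rewrite -(ler_pXn2r (_ : (0 < 2)%N))// ?nnegrE// real_normK ?num_real//.
rewrite !exprMn -exprM mulnC exprM.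
apply: (@le_trans _ _ (phi x ^+ 2 * phi y ^+ 2 * (sqn x * sqn y) ^+ k)).
  apply: ler_wpM2l; first by rewrite mulr_ge0 ?sqr_ge0.
  case: k {hB} => // k.
  by rewrite ler_pXn2r ?nnegrE ?sqr_ge0 ?mulr_ge0 ?sqn_ge0// dotr_sqr_le.
rewrite exprMn mulrACA [B ^+ 2]expr2 ler_pM ?hB// mulr_ge0 ?sqr_ge0//;
  by rewrite exprn_ge0// sqn_ge0.
Qed.

(** One factor of the dot product is split into coordinates and [x_i] is absorbed into the weight;
    since [x_i^2 <= |x|^2], the new weights satisfy the same bound with one power less. At [k = 0]
    the kernel is a tensor square. *)
Lemma qform_weighted_dotr k : forall (phi : Rn R n -> R) B,
  measurable_fun setT phi -> (forall x, phi x ^+ 2 * sqn x ^+ k <= B) ->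
  0 <= qform c m (fun z => phi z.1 * phi z.2 * dotr z.1 z.2 ^+ k).
Proof.
elim: k => [|k IH] phi B mphi hB.
  rewrite [X in qform c m X](_ : _ = fun z => phi z.1 * phi z.2).
    apply: qform_tensor; split => //; exists (1 + B) => x.
    have := hB x; rewrite expr0 mulr1 => h.
    have := sqr_ge0 (`|phi x| - 1); rewrite -(real_normK (num_real (phi x))) in h.
    nra.
  by apply/funext => z; rewrite expr0 mulr1.
pose psi i (x : Rn R n) := phi x * (x : 'rV[R]_n) 0 i.
have mpsi i : measurable_fun setT (psi i).
  by apply: measurable_funM => //; exact: measurable_coord.
have hpsi i x : psi i x ^+ 2 * sqn x ^+ k <= B.
  apply: le_trans (hB x); rewrite exprMn [sqn x ^+ k.+1]exprS -mulrA.
  apply: ler_wpM2l; first exact: sqr_ge0.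
  apply: ler_wpM2r; last exact: coord_sqr_le_sqn.
  by rewrite exprn_ge0// sqn_ge0.
rewrite [X in qform c m X](_ : _ = fun z =>
    \sum_(i < n) (psi i z.1 * psi i z.2 * dotr z.1 z.2 ^+ k)); last first.
  apply/funext => -[x y] /=; rewrite -mulr_suml exprSr /psi mulrA mulrC mulrA.
  congr (_ * _); rewrite /dotr mulr_suml; apply: eq_bigr => i _; ring.
rewrite qform_sum; last first.
  by move=> i; exact: (bmeas_weighted_dotr (mpsi i) (hpsi i)).
by apply: sumr_ge0 => i _; exact: (IH _ _ (mpsi i) (hpsi i)).
Qed.

Definition gaussk (t : R) (z : Rn R n * Rn R n) : R :=
  expR (- (t * sqn ((z.1 : 'rV[R]_n) - z.2))).

Lemma measurable_gaussk t : measurable_fun setT (gaussk t).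
Proof.
apply: measurableT_comp => //; apply: measurableT_comp => //.
by apply: measurable_funM => //; exact: measurable_sqnB.
Qed.

Lemma gaussk_ge0 t z : 0 <= gaussk t z.
Proof. exact: expR_ge0. Qed.

Lemma gaussk_le1 t z : 0 <= t -> gaussk t z <= 1.
Proof. by move=> t0; rewrite expR_le1 oppr_le0 mulr_ge0// sqn_ge0. Qed.

Lemma bmeas_gaussk t : 0 <= t -> bmeas (gaussk t).
Proof.
move=> t0; split; first exact: measurable_gaussk.
by exists 1 => z; rewrite ger0_norm ?gaussk_ge0// gaussk_le1.
Qed.

Lemma series_exp_coeff_le (x : R) N : 0 <= x -> series (exp_coeff x) N <= expR x.
Proof.
move=> x0; rewrite /expR.
apply: (nondecreasing_cvgn_le _ (is_cvg_series_exp_coeff x)).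
apply/nondecreasing_seqP => k; rewrite /series/= big_nat_recr//= lerDl.
by rewrite exp_coeffE mulr_ge0 ?invr_ge0 ?exprn_ge0.
Qed.

(* exp(-t|x-y|^2) = exp(-t|x|^2) exp(-t|y|^2) sum_i (2t)^i (x.y)^i / i!, and
   every power of the dot product is a positive definite kernel. *)
Lemma qform_gaussk_ge0 t : 0 <= t -> 0 <= qform c m (gaussk t).
Proof.
(* At [t = 0] the kernel is constant; the weight bounds below divide by powers of [2 t]. *)
rewrite le_eqVlt => /predU1P[<-|t0].
  rewrite (_ : gaussk 0 = fun z => (fun=> 1) z.1 * (fun=> 1) z.2).
    exact: (qform_tensor c m (bmeas_cst (Rn R n) 1)).
  by apply/funext => z; rewrite /gaussk mul0r oppr0 expR0 mulr1.
pose phi (x : Rn R n) := expR (- (t * sqn x)).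
have mphi : measurable_fun setT phi.
  apply: measurableT_comp => //; apply: measurableT_comp => //.
  by apply: measurable_funM => //; exact: measurable_sqn.
have t20 : 0 < 2 * t by rewrite mulr_gt0.
(* With [w = 2 t |x|^2] the left side is [exp(-w) w^k / (2 t)^k], and [w^k <= k! exp(w)]. *)
have hphi k x : phi x ^+ 2 * sqn x ^+ k <= k`!%:R / (2 * t) ^+ k.
  have -> : phi x ^+ 2 = (expR (2 * t * sqn x))^-1.
    by rewrite /phi -expRM_natl mulrN expRN mulrA.
  rewrite ler_pdivlMr ?exprn_gt0//.
  rewrite (_ : _ * _ * _ = (expR (2 * t * sqn x))^-1 * (2 * t * sqn x) ^+ k);
    last by rewrite !exprMn; ring.
  rewrite ler_pdivrMl ?expR_gt0//.
  have s0 : 0 <= 2 * t * sqn x by rewrite mulr_ge0 ?sqn_ge0// ltW.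
  case: k => [|k].
    by rewrite fact0 mulr1 expr0 -[leLHS]expR0 ler_expR.
  rewrite -ler_pdivrMr ?ltr0n ?fact_gt0//.
  by apply: le_trans (expR_ge1Dxn k s0); rewrite lerDr.
pose term i (z : Rn R n * Rn R n) := (2 * t) ^+ i / i`!%:R *
  (phi z.1 * phi z.2 * dotr z.1 z.2 ^+ i).
have bterm i : bmeas (term i).
  apply: bmeasM; first exact: bmeas_cst.
  exact: (bmeas_weighted_dotr mphi (hphi i)).
pose H N z := \sum_(0 <= i < N) term i z.
have HE N z : H N z =
    phi z.1 * phi z.2 * series (exp_coeff (2 * t * dotr z.1 z.2)) N.
  rewrite /H /series/= mulr_sumr; apply: eq_bigr => i _.
  by rewrite /term exp_coeffE !exprMn; ring.
(* The bound 1 is uniform in [N]: a partial sum is at most [exp(2 t |x.y|)] in absolute value, and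
   [2 |x.y| <= |x|^2 + |y|^2]. *)
apply: (@qform_cvg_ge0 _ _ _ _ c m H _ 1).
- by move=> N; exact: (bmeas_sum (index_iota 0 N) bterm).1.
- exact: measurable_gaussk.
- move=> N [x y]; rewrite HE /= normrM ger0_norm; last first.
    by rewrite mulr_ge0// expR_ge0.
  apply: (@le_trans _ _ (phi x * phi y * expR (2 * t * `|dotr x y|))).
    rewrite ler_wpM2l ?mulr_ge0 ?expR_ge0//.
    apply: le_trans (series_exp_coeff_le N _); last by rewrite mulr_ge0// ltW.
    rewrite /series/=; apply: le_trans (ler_norm_sum _ _ _) _.
    apply: ler_sum => i _; rewrite !exp_coeffE normrM normrX.
    by rewrite ger0_norm ?invr_ge0// normrM (gtr0_norm t20).
  rewrite /phi -!expRD expR_le1.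
  by have := dotr_le x y; nra.
- move=> [x y]; under eq_fun do rewrite HE.
  have -> : gaussk t (x, y) = phi x * phi y * expR (2 * t * dotr x y).
    rewrite /phi -!expRD /gaussk /=; congr expR; rewrite sqnB; ring.
  apply: cvgM; first exact: cvg_cst.
  exact: is_cvg_series_exp_coeff.
- move=> N; rewrite /H qform_sum//; apply: sumr_ge0 => i _.
  rewrite qformZ; last exact: (bmeas_weighted_dotr mphi (hphi i)).
  rewrite mulr_ge0//; first by rewrite divr_ge0// exprn_ge0// ltW.
  exact: (qform_weighted_dotr mphi (hphi i)).
Qed.

End gaussian_form.

Section Rintegral_sum.
Context d (T : measurableType d) (R : realType) (mu : {measure set T -> \bar R}).

Lemma Rintegral_sum (J : Type) (s : seq J) (F : J -> T -> R) (D : set T) :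
  measurable D -> (forall j, mu.-integrable D (EFin \o F j)) ->
  mu.-integrable D (EFin \o (fun v => \sum_(j <- s) F j v)) /\
  \int[mu]_(v in D) (\sum_(j <- s) F j v) = \sum_(j <- s) \int[mu]_(v in D) F j v.
Proof.
move=> mD iF; elim: s => [|j s [IH1 IH2]].
  split.
    rewrite (_ : _ \o _ = cst 0%E); first exact: integrable0.
    by apply/funext => v /=; rewrite big_nil.
  by under eq_Rintegral do rewrite big_nil; rewrite Rintegral_cst// mul0r big_nil.
rewrite big_cons -IH2 -RintegralD//; split.
  rewrite (_ : _ \o _ = ((EFin \o F j) \+
    (EFin \o (fun v => (\sum_(j <- s) F j v)%R)))%E); first exact: integrableD.
  by apply/funext => v /=; rewrite big_cons EFinD.
by apply: eq_Rintegral => v _; rewrite big_cons.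
Qed.

End Rintegral_sum.

(** * Riesz energies as integrals of Gaussian energies *)

Section laplace_energy.
Context (R : realType) (n : nat) (alpha : R).
Hypothesis alpha_ltn : alpha < n%:R.
Local Notation leb := (@lebesgue_measure R).
Local Notation r := (riesz_exp n alpha).
Local Notation halfline := (`[(0%R : R), +oo[%classic).
Local Notation mass := (stretched_mass r^-1).

Let r0 : 0 < r. Proof. exact: riesz_exp_gt0. Qed.

Let M := fine mass.

Let massE : M%:E = mass.
Proof.
rewrite fineK// ge0_fin_numE; first by rewrite stretched_mass_lty// invr_gt0.
by apply/ltW; rewrite stretched_mass_gt0// invr_gt0.
Qed.

Let M0 : 0 < M.
Proof. by rewrite -lte_fin massE stretched_mass_gt0// invr_gt0. Qed.

(** For [u > 0] this is [stretched_scaling] with factor [u^r], as [(v u^r)^(1/r) = v^(1/r) u]. At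
    [u = 0] the integrand is 1 and both sides are [+oo]. *)
Lemma rprofile_laplace u : 0 <= u ->
  (M%:E * rprofile n alpha u =
   \int[leb]_(v in halfline) (expR (- (v `^ r^-1 * u)))%:E)%E.
Proof.
rewrite le_eqVlt => /predU1P[<-|u0].
  rewrite /rprofile eqxx gt0_muley ?lte_fin//.
  under eq_integral do rewrite mulr0 oppr0 expR0.
  by rewrite integral_cst//= lebesgue_measure_itv/= mul1e ltry addye.
rewrite massE (@stretched_scaling _ _ _ (u `^ r)) ?invr_gt0 ?powR_gt0//.
rewrite /rprofile gt_eqF// muleAC -EFinM powRN mulfV ?gt_eqF ?powR_gt0// mul1e.
apply: eq_integral => v; rewrite inE/= in_itv/= andbT => v0.
rewrite /stretched powRM ?powR_ge0// -powRrM mulfV ?gt_eqF// powRr1//.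
exact: ltW.
Qed.

Implicit Types m : {finite_measure set (Rn R n) -> \bar R}.

(* Mutual energy of [m1] and [m2] for the Gaussian kernel exp(-t |x - y|^2) at
   t = v^(1/r), r = (n - alpha) / 2; integrating it in v over the half-line
   gives a multiple of the Riesz energy. *)
Definition gint m1 m2 (v : R) : R :=
  \int[(m1 \x m2)%E]_z gaussk (v `^ r^-1) z.

Let gintE m1 m2 v : ((gint m1 m2 v)%:E =
  \int[m1 \x m2]_z (gaussk (v `^ r^-1) z)%:E)%E.
Proof.
rewrite fineK//; apply: integrable_fin_num => //.
apply: (bmeas_integrable (finite_prod_lty _ _)).
by apply: bmeas_gaussk; exact: powR_ge0.
Qed.

Let measurable_gaussk2 : measurable_fun setT
  (fun w : (Rn R n * Rn R n) * R => gaussk (w.2 `^ r^-1) w.1).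
Proof.
apply: measurableT_comp => //; apply: measurableT_comp => //.
apply: measurable_funM.
  exact: (measurableT_comp (measurable_powR _) measurable_snd).
exact: (measurableT_comp measurable_sqnB measurable_fst).
Qed.

(** The half-line enters as an indicator factor, so that Tonelli applies on the full product
    space. *)
Let halfker (w : (Rn R n * Rn R n) * R) : \bar R :=
  ((gaussk (w.2 `^ r^-1) w.1)%:E * (\1_halfline w.2)%:E)%E.

Let measurable_halfker : measurable_fun setT halfker.
Proof.
apply: emeasurable_funM; first exact/measurable_EFinP.
apply/measurable_EFinP.
exact: (measurableT_comp (measurable_indic _) measurable_snd).
Qed.

Let halfker_ge0 w : (0 <= halfker w)%E.
Proof. by rewrite mule_ge0// lee_fin ?gaussk_ge0. Qed.

Lemma gint_ge0 m1 m2 v : 0 <= gint m1 m2 v.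
Proof. by apply: Rintegral_ge0 => z _; exact: gaussk_ge0. Qed.

Lemma measurable_gint m1 m2 : measurable_fun setT (gint m1 m2).
Proof.
apply/measurable_EFinP.
rewrite [X in measurable_fun _ X](_ : _ = fun v =>
    \int[m1 \x m2]_z (gaussk (v `^ r^-1) z)%:E)%E; last first.
  by apply/funext => v; rewrite /= gintE.
apply: (@measurable_prod_param _ _ _ m1 m2 _ _
  (fun w => (gaussk (w.2 `^ r^-1) w.1)%:E)).
  exact/measurable_EFinP.
by move=> w; rewrite lee_fin gaussk_ge0.
Qed.

Lemma energy_prod m1 m2 : energy alpha m1 m2 =
  (\int[m1 \x m2]_z riesz alpha (z.1 : 'rV[R]_n) z.2)%E.
Proof.
rewrite fubini_tonelli1//; first exact: measurable_riesz2.
by move=> z; exact: riesz_ge0.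
Qed.

Lemma energy_gint m1 m2 : (M%:E * energy alpha m1 m2 =
  \int[leb]_(v in halfline) (gint m1 m2 v)%:E)%E.
Proof.
rewrite energy_prod -ge0_integralZl//; first last.
- by rewrite lee_fin ltW.
- by move=> z _; exact: riesz_ge0.
- exact: measurable_riesz2.
transitivity (\int[m1 \x m2]_z \int[leb]_v halfker (z, v))%E.
  apply: eq_integral => z _; rewrite rieszE rprofile_laplace ?sqn_ge0//.
  rewrite integral_mkcond; apply: eq_integral => v _.
  by rewrite /halfker patchE indicE /=; case: ifPn => _; rewrite (mule1, mule0).
rewrite prod_param_tonelli// [RHS]integral_mkcond; apply: eq_integral => v _.
rewrite patchE; case: ifPn => vh.
  rewrite gintE; apply: eq_integral => z _.
  by rewrite /halfker /= indicE vh mule1.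
apply: integral0_eq => z _.
by rewrite /halfker /= indicE (negbTE vh) mule0.
Qed.

Let gint_integrable m1 m2 : (energy alpha m1 m2 < +oo)%E ->
  leb.-integrable halfline (EFin \o gint m1 m2).
Proof.
move=> fin; apply/integrableP; split.
  by apply/measurable_EFinP; apply: measurable_funTS; exact: measurable_gint.
under eq_integral do rewrite /= ger0_norm ?gint_ge0//.
rewrite -energy_gint lte_mul_pinfty// lee_fin; exact: ltW.
Qed.

Lemma energy_ge0 (m1 m2 : bmeasure R n) : (0 <= energy alpha m1 m2)%E.
Proof.
apply: integral_ge0 => x _; apply: integral_ge0 => y _; exact: riesz_ge0.
Qed.

Lemma energyC m1 m2 : energy alpha m1 m2 = energy alpha m2 m1.
Proof.
rewrite /energy /potential (fubini_tonelli
  (fun z : Rn R n * Rn R n => riesz alpha (z.1 : 'rV[R]_n) z.2)).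
- apply: eq_integral => x _; apply: eq_integral => y _; exact: rieszC.
- exact: measurable_riesz2.
- by move=> z; exact: riesz_ge0.
Qed.

(** For each Gaussian, positivity of the form with weights 1 and -1 bounds the mutual term by the
    sum of the two self terms. The bound is taken before integrating in [v], where all quantities
    are still real. *)
Lemma energy_mutual_lty m1 m2 : (energy alpha m1 m1 < +oo)%E ->
  (energy alpha m2 m2 < +oo)%E -> (energy alpha m1 m2 < +oo)%E.
Proof.
move=> f1 f2.
have : (M%:E * energy alpha m1 m2 < +oo)%E.
  rewrite energy_gint.
  apply: (@le_lt_trans _ _ (\int[leb]_(v in halfline)
    ((gint m1 m1 v)%:E + (gint m2 m2 v)%:E))%E).
    apply: ge0_le_integral => //.
    - by move=> v _; rewrite lee_fin gint_ge0.
    - by apply/measurable_EFinP; apply: measurable_funTS; exact: measurable_gint.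
    - by apply: emeasurable_funD; apply/measurable_EFinP;
        apply: measurable_funTS; exact: measurable_gint.
    - move=> v _; rewrite -EFinD lee_fin.
      have := qform_gaussk_ge0 (fun b : bool => if b then 1 else -1)
        (fun b : bool => if b then m1 else m2) (powR_ge0 v r^-1).
      rewrite /qform !big_bool /= -!/(gint _ _ _).
      by have := gint_ge0 m2 m1 v; lra.
  rewrite ge0_integralD//.
  - by rewrite -!energy_gint lte_add_pinfty// lte_mul_pinfty// lee_fin ltW.
  - by move=> v _; rewrite lee_fin gint_ge0.
  - by apply/measurable_EFinP; apply: measurable_funTS; exact: measurable_gint.
  - by move=> v _; rewrite lee_fin gint_ge0.
  - by apply/measurable_EFinP; apply: measurable_funTS; exact: measurable_gint.
have := energy_ge0 m1 m2; case: (energy alpha m1 m2) => [e _ _|_|//].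
  by rewrite ltry.
by rewrite gt0_muley ?lte_fin.
Qed.

(** Positivity for each Gaussian, integrated in [v]. Finiteness of all mutual energies allows the
    signed double sum to be exchanged with that integral. *)
Lemma energy_form_ge0 (J : finType) (c : J -> R)
    (m : J -> {finite_measure set (Rn R n) -> \bar R}) :
  (forall p q, (energy alpha (m p) (m q) < +oo)%E) ->
  0 <= \sum_p \sum_q c p * c q * fine (energy alpha (m p) (m q)).
Proof.
move=> fin; rewrite -(pmulr_rge0 _ M0).
have e p q : M * fine (energy alpha (m p) (m q)) =
    \int[leb]_(v in halfline) gint (m p) (m q) v.
  rewrite /Rintegral -energy_gint fineM//.
  by rewrite ge0_fin_numE// energy_ge0.
have i1 p q : leb.-integrable halfline
    (EFin \o (fun v => c p * c q * gint (m p) (m q) v)).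
  rewrite (_ : _ \o _ = fun v => ((c p * c q)%:E * (gint (m p) (m q) v)%:E)%E).
    by apply: integrableZl => //; exact: gint_integrable.
  by apply/funext => v; rewrite /= EFinM.
have i2 p := @Rintegral_sum _ _ _ leb _ (index_enum J)
  (fun q v => c p * c q * gint (m p) (m q) v) halfline (measurable_itv _) (i1 p).
have i3 := @Rintegral_sum _ _ _ leb _ (index_enum J)
  (fun p v => \sum_q c p * c q * gint (m p) (m q) v) halfline (measurable_itv _)
  (fun p => (i2 p).1).
rewrite (_ : _ * _ = \int[leb]_(v in halfline)
    (\sum_p \sum_q c p * c q * gint (m p) (m q) v)).
  by apply: Rintegral_ge0 => v _; apply: qform_gaussk_ge0; exact: powR_ge0.
rewrite i3.2 mulr_sumr; apply: eq_bigr => p _.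
rewrite (i2 p).2 mulr_sumr; apply: eq_bigr => q _.
rewrite mulrCA e RintegralZl//; exact: gint_integrable.
Qed.

End laplace_energy.

(** * Continuity of potentials *)

Section convergence_of_integrals.
Context d (T : measurableType d) (R : realType) (mu : {measure set T -> \bar R}).
Local Open Scope ereal_scope.

Lemma lt_limn_einf_near (u : nat -> \bar R) (a : \bar R) :
  a < limn_einf u -> \forall k \near \oo, a < u k.
Proof.
rewrite limn_einf_lim => h.
have [m hm] : exists m, a < einfs u m.
  apply/not_existsP => hn.
  suff : limn (einfs u) <= a by rewrite leNgt h.
  apply: lime_le; first by apply: is_cvg_einfs.
  by apply: nearW => m; rewrite leNgt; apply/negP; exact: hn.
exists m => // k mk; apply: lt_le_trans hm _.
by apply: ereal_inf_lbound; exists k.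
Qed.

(** Fatou read as lower semicontinuity along a sequence, the form in which it is applied to
    potentials. *)
Lemma fatou_near (D : set T) (F : nat -> T -> \bar R) (Finf : T -> \bar R) a :
  measurable D -> (forall k, measurable_fun D (F k)) ->
  (forall k x, D x -> 0 <= F k x) ->
  (forall x, D x -> F k x @[k --> \oo] --> Finf x) ->
  a < \int[mu]_(x in D) Finf x ->
  \forall k \near \oo, a < \int[mu]_(x in D) F k x.
Proof.
move=> mD mF F0 cF h; apply: lt_limn_einf_near; apply: lt_le_trans (fatou mu mD mF F0).
rewrite (eq_integral Finf)// => x /[!inE] Dx.
by have [] := cvg_limn_einf_sup (cF x Dx).
Qed.

(** Dominated convergence with a majorant that varies with the index: Fatou for [F] bounds the
    integrals from below, and Fatou for [H - F] together with convergence of the integrals of [H]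
    bounds them from above. *)
Lemma pratt (D : set T) (F H : nat -> T -> \bar R) (Finf Hinf : T -> \bar R) :
  measurable D -> (forall k, measurable_fun D (F k)) ->
  (forall k, measurable_fun D (H k)) ->
  (forall k x, D x -> 0 <= F k x <= H k x) ->
  (forall x, D x -> F k x @[k --> \oo] --> Finf x) ->
  (forall x, D x -> H k x @[k --> \oo] --> Hinf x) ->
  (forall x, D x -> Hinf x < +oo) ->
  measurable_fun D Finf -> measurable_fun D Hinf ->
  \int[mu]_(x in D) Hinf x < +oo ->
  \int[mu]_(x in D) H k x @[k --> \oo] --> \int[mu]_(x in D) Hinf x ->
  \int[mu]_(x in D) F k x @[k --> \oo] --> \int[mu]_(x in D) Finf x.
Proof.
move=> mD mF mH FH cF cH Hfin mFi mHi iH cvgH.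
have F0 k x : D x -> 0 <= F k x by move=> Dx; have /andP[] := FH k x Dx.
have H0 k x : D x -> 0 <= H k x.
  by move=> Dx; have /andP[] := FH k x Dx; exact: le_trans.
have Fi0 x : D x -> 0 <= Finf x.
  by move=> Dx; apply: (cvge_ge _ (cF x Dx)); apply: nearW => k; exact: F0.
have Hi0 x : D x -> 0 <= Hinf x.
  by move=> Dx; apply: (cvge_ge _ (cH x Dx)); apply: nearW => k; exact: H0.
have FHi x : D x -> Finf x <= Hinf x.
  move=> Dx; apply: (lee_cvg_to (cF x Dx) (cH x Dx)).
  by apply: nearW => k; have /andP[] := FH k x Dx.
(* The difference [H - F], set to [+oo] where [H] is infinite, so that [F + G = H] holds on all of
   [D]. *)
pose G k x := if H k x == +oo then +oo else H k x - F k x.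
have mG k : measurable_fun D (G k).
  apply: measurable_fun_if => //.
  - apply: (measurable_fun_bool true) => //.
    rewrite (_ : _ @^-1` _ = H k @^-1` [set +oo]); first exact: mH.
    by apply/seteqP; split => x /=; [move/eqP|move=> ->; rewrite eqxx].
  - by apply: emeasurable_funB; apply: measurable_funS (_ : _ `<=` D) _ => //;
      exact: subIsetl.
have G0 k x : D x -> 0 <= G k x.
  move=> Dx; rewrite /G; case: eqP => // Hoo; rewrite sube_ge0.
    by have /andP[] := FH k x Dx.
  by apply/orP; right; rewrite ge0_fin_numE ?H0// ltey; exact/eqP.
have FGH k x : D x -> F k x + G k x = H k x.
  move=> Dx; rewrite /G; case: eqP => [->|/eqP Hoo].
    by rewrite addey// gt_eqF// (lt_le_trans _ (F0 k x Dx)).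
  rewrite addeC subeK// ge0_fin_numE ?F0//.
  have /andP[_ /le_lt_trans] := FH k x Dx; apply.
  by rewrite ltey.
have cG x : D x -> G k x @[k --> \oo] --> Hinf x - Finf x.
  move=> Dx; have Hf : Hinf x \is a fin_num by rewrite ge0_fin_numE ?Hi0 ?Hfin.
  have Ff : Finf x \is a fin_num.
    by rewrite ge0_fin_numE ?Fi0// (le_lt_trans (FHi x Dx))// Hfin.
  apply: cvg_trans (cvgeB _ (cH x Dx) (cF x Dx)); last first.
    by rewrite fin_num_adde_defl// fin_numN.
  apply: near_eq_cvg.
  have : H k x @[k --> \oo] --> (fine (Hinf x))%:E by rewrite fineK//; exact: cH.
  move=> /fine_cvgP[+ _]; apply: filterS => k Hk.
  by rewrite /G; case: eqP => // e; rewrite e in Hk.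
have iF : \int[mu]_(x in D) Finf x \is a fin_num.
  rewrite ge0_fin_numE ?integral_ge0//; apply: le_lt_trans iH.
  exact: ge0_le_integral.
have iHf : \int[mu]_(x in D) Hinf x \is a fin_num.
  by rewrite ge0_fin_numE ?integral_ge0.
have iG : \int[mu]_(x in D) (Hinf x - Finf x) =
    \int[mu]_(x in D) Hinf x - \int[mu]_(x in D) Finf x.
  rewrite integralB// ; apply/integrableP; split => //.
    rewrite (eq_integral Hinf)// => x /[!inE] Dx; by rewrite gee0_abs// Hi0.
  rewrite (eq_integral Finf) ?ltey_eq ?iF// => x /[!inE] Dx.
  by rewrite gee0_abs// Fi0.
have eFGH k : \int[mu]_(x in D) F k x + \int[mu]_(x in D) G k x =
    \int[mu]_(x in D) H k x.
  rewrite -ge0_integralD//; [|exact: F0|exact: G0].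
  by apply: eq_integral => x /[!inE] Dx; exact: FGH.
have iF0 k : 0 <= \int[mu]_(x in D) F k x by apply: integral_ge0; exact: F0.
have iG0 k : 0 <= \int[mu]_(x in D) G k x by apply: integral_ge0; exact: G0.
set a := \int[mu]_(x in D) Finf x in iF iG *.
set b := \int[mu]_(x in D) Hinf x in iHf iG cvgH *.
have ea : a = (fine a)%:E by rewrite fineK.
have eb : b = (fine b)%:E by rewrite fineK.
rewrite ea.
have key (e : R) : (0 < e)%R -> \forall k \near \oo,
   (fine a - e)%:E < \int[mu]_(x in D) F k x < (fine a + e)%:E.
  move=> e0; have e20 : (0 < e / 2)%R by rewrite divr_gt0.
  have hF : \forall k \near \oo, (fine a - e)%:E < \int[mu]_(x in D) F k x.
    apply: (@fatou_near _ _ Finf) => //.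
    by rewrite -/a ea lte_fin ltrBlDr ltrDl.
  have hG : \forall k \near \oo,
      (fine b - fine a - e / 2)%:E < \int[mu]_(x in D) G k x.
    apply: (@fatou_near _ _ (fun x => Hinf x - Finf x)) => //.
    by rewrite iG ea eb -EFinB lte_fin ltrBlDr ltrDl.
  have hH : \forall k \near \oo,
      \int[mu]_(x in D) H k x < (fine b + e / 2)%:E.
    move: cvgH; rewrite eb => /fine_cvgP[hf /cvgrPdist_lt /(_ _ e20)].
    apply: filterS2 hf => k hk; rewrite /= ltr_distl => /andP[h1 h2].
    by rewrite -[ltLHS]fineK// lte_fin; lra.
  apply: filterS3 hF hG hH => k hF hG hH; apply/andP; split => //.
  move: hH hG; rewrite -eFGH; move: (iF0 k) (iG0 k).
  case: (\int[mu]_(x in D) G k x) => [q| |] //;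
    case: (\int[mu]_(x in D) F k x) => [p| |] //.
  by rewrite -EFinD !lte_fin => _ h1 h2; lra.
apply/fine_cvgP; split.
  have := key _ ltr01; apply: filterS => k /andP[_ h].
  by rewrite ge0_fin_numE// (lt_trans h)// ltry.
apply/cvgrPdist_lt => e e0; have := key _ e0; apply: filterS => k /=.
have := iF0 k; case: (\int[mu]_(x in D) F k x) => [p| |]//= _.
  by rewrite !lte_fin => /andP[h1 h2]; rewrite ltr_distl; apply/andP; split; lra.
by rewrite andbF.
Qed.

End convergence_of_integrals.

Section finite_alias.
Context d (T : measurableType d) (R : realType) (mu : {measure set T -> \bar R}).

(** The finiteness proof is an argument, so that a measure finite only by hypothesis acquires the
    finite-measure structure that Fubini asks for. *)
Definition fmeas of (mu setT < +oo)%E : set T -> \bar R := mu.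

Variable muT : (mu setT < +oo)%E.

HB.instance Definition _ := Measure.on (fmeas muT).

Let fmeas_fin : fin_num_fun (fmeas muT).
Proof.
move=> A mA; rewrite ge0_fin_numE//; apply: le_lt_trans muT.
by apply: le_measure; rewrite ?inE.
Qed.

HB.instance Definition _ := Measure_isFinite.Build _ _ _ (fmeas muT) fmeas_fin.

End finite_alias.

Lemma measurable_Rn_set1 {R : realType} {n : nat} (x : 'rV[R]_n) :
  measurable ([set x] : set (Rn R n)).
Proof.
apply: closed_Rn_measurable; apply: accessible_closed_set1.
by apply: hausdorff_accessible; exact: norm_hausdorff.
Qed.

(** * Supports and distances to closed sets *)

Section support.
Context {R : realType} {n : nat}.
Implicit Types (mu : bmeasure R n) (A : set 'rV[R]_n).

Lemma sqn_lt_ball (x y : 'rV[R]_n) (e : R) : 0 < e -> sqn (x - y) < e ^+ 2 -> ball x e y.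
Proof.
move=> e0 h; split => // i k; rewrite (ord1 i) /ball/=.
rewrite -(ltr_pXn2r (_ : (0 < 2)%N))// ?nnegrE//; last exact: ltW.
rewrite real_normK ?num_real//; apply: le_lt_trans h.
by apply: le_trans (coord_sqr_le_sqn _ k); rewrite !mxE.
Qed.

Lemma closed_sqn_gap A (x : 'rV[R]_n) : closed A -> ~ A x ->
  exists2 e, 0 < e & forall y, A y -> e <= sqn (x - y).
Proof.
move=> cA Ax; have : nbhs x (~` A).
  by apply: open_nbhs_nbhs; split => //; exact: closed_openC.
move=> /nbhs_ballP[e /= e0 he]; exists (e ^+ 2); first by rewrite exprn_gt0.
move=> y Ay; rewrite leNgt; apply/negP => /(sqn_lt_ball e0) xy.
exact: (he _ xy).
Qed.

(** An approximate minimizer replaces a nearest point: off [A] the infimum of the squared distances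
    is positive, so some point of [A] stays below twice that infimum. *)
Lemma near_projection A (x : 'rV[R]_n) : closed A -> A !=set0 ->
  exists2 x', A x' & forall y, A y -> sqn (x - x') <= 4 * sqn (x - y).
Proof.
move=> cA [a0 Aa0]; have [Ax|Ax] := pselect (A x).
  exists x => // y _; rewrite subrr.
  by rewrite sqn0 mulr_ge0 ?sqn_ge0.
have [e e0 he] := closed_sqn_gap cA Ax.
pose S := [set sqn (x - y) | y in A].
have infS : has_inf S.
  by split; [exists (sqn (x - a0)); exists a0|exists e => _ [y Ay <-]; exact: he].
have eS : e <= inf S by apply: lb_le_inf; [exact: infS.1|move=> _ [y Ay <-]; exact: he].
have i0 : 0 < inf S by exact: lt_le_trans eS.
have [_ [x' Ax' <-] hx'] := inf_adherent i0 infS.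
exists x' => // y Ay; apply: (le_trans (ltW hx')).
have : inf S <= sqn (x - y) by apply: ge_inf; [exact: infS.2|exists y].
lra.
Qed.

(** Balls with rational centre and radius [1/(k+1)], a countable base of the topology. *)
Let qball (w : 'rV[rat]_n * nat) : set 'rV[R]_n :=
  ball (map_mx (@ratr R) w.1) (w.2.+1%:R^-1).

Let qball_open w : open (qball w).
Proof. by apply: ball_open; rewrite invr_gt0. Qed.

Let qball_basis (U : set 'rV[R]_n) x : open U -> U x ->
  exists w, qball w x /\ qball w `<=` U.
Proof.
move=> oU Ux; have : nbhs x U by apply: open_nbhs_nbhs.
move=> /nbhs_ballP[e /= e0 he].
pose k := Num.truncn (2 / e).
have ek : 2 * k.+1%:R^-1 <= e.
  by rewrite ler_pdivrMr// mulrC -ler_pdivrMr//; apply/ltW; exact: truncnS_gt.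
have k0 : 0 < k.+1%:R^-1 :> R by rewrite invr_gt0.
have [q hq] : {q : 'I_n -> rat & forall i, `|x 0 i - ratr (q i)| < k.+1%:R^-1}.
  apply: (@choice _ _ (fun i q => `|x 0 i - ratr q| < k.+1%:R^-1)) => i.
  move: k0; set d := k.+1%:R^-1 => d0.
  have : x 0 i - d < x 0 i + d by lra.
  move=> /rat_in_itvoo[q]; rewrite in_itv/= => /andP[q1 q2].
  by exists q; rewrite ltr_distl; apply/andP; split; lra.
exists (\row_i q i, k).
have xb : qball (\row_i q i, k) x.
  by split => // i j; rewrite !mxE (ord1 i) /ball/= distrC.
split => // y yb; apply: he; apply: (le_ball ek).
rewrite mulrDl mul1r; apply: ball_triangle yb.
exact: ball_sym.
Qed.

Lemma msupport_closed mu : closed (msupport mu).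
Proof.
rewrite -[msupport mu]setCK; apply: open_closedC.
rewrite openE => x /= /existsNP[U /not_implyP[oU /not_implyP[Ux hU]]].
apply: (filterS _ (open_nbhs_nbhs (conj oU Ux))) => y Uy h.
exact/hU/(h _ oU Uy).
Qed.

(** Each point off the support has a null neighbourhood, hence lies in a null ball of the countable
    base; countably many null balls have a null union. *)
Lemma msupport_null mu : mu (~` msupport mu) = 0%E.
Proof.
have mS : measurable (~` msupport mu : set (Rn R n)).
  by apply: open_Rn_measurable; apply: closed_openC; exact: msupport_closed.
pose B (j : nat) : set (Rn R n) := if unpickle j is Some w then
  (if mu (qball w) == 0%E then qball w else set0) else set0.
have BN : mu.-negligible (\bigcup_j B j).
  apply: negligible_bigcup => j; rewrite /B; case: unpickle => [w|]; last first.
    exact: negligible_set0.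
  case: ifPn => [/eqP w0|_]; last exact: negligible_set0.
  by apply/negligibleP => //; apply: open_Rn_measurable; exact: qball_open.
apply/negligibleP => //; apply: negligibleS BN.
move=> x /= /existsNP[U /not_implyP[oU /not_implyP[Ux /negP hU]]].
have [w [xw wU]] := qball_basis oU Ux.
exists (pickle w) => //; rewrite /B pickleK.
have -> : mu (qball w) == 0%E; last by [].
rewrite eq_le measure_ge0 andbT leNgt; apply: contra hU => h.
apply: (lt_le_trans h); apply: le_measure => //; rewrite inE;
  exact: open_Rn_measurable.
Qed.

Lemma msupport_sub_null mu A : closed A -> msupport mu `<=` A -> mu (~` A) = 0%E.
Proof.
move=> cA SA; apply: subset_measure0 (msupport_null mu) => //.
- by apply: open_Rn_measurable; exact: closed_openC.
- by apply: open_Rn_measurable; apply: closed_openC; exact: msupport_closed.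
- exact: subsetC.
Qed.

Lemma null_msupport_sub mu A : closed A -> mu (~` A) = 0%E -> msupport mu `<=` A.
Proof.
move=> cA A0 x Sx; apply: contrapT => Ax.
by have := Sx _ (closed_openC cA) Ax; rewrite A0 ltxx.
Qed.

End support.

Lemma ge0_integral_conull d (T : measurableType d) (R : realType)
    (mu : {measure set T -> \bar R}) (D : set T) (h : T -> \bar R) :
  measurable D -> mu (~` D) = 0%E -> measurable_fun setT h ->
  (forall x, 0 <= h x)%E -> (\int[mu]_x h x = \int[mu]_(x in D) h x)%E.
Proof.
move=> mD D0 mh h0.
by rewrite (ge0_negligible_integral (measurableC mD)) ?setTD ?setCK.
Qed.

Section potential_continuity.
Context {R : realType} (n : nat) (alpha : R).
Hypothesis alpha_ltn : alpha < n%:R.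
Variables (mu sigma : bmeasure R n) (A : set 'rV[R]_n).
Hypotheses (mu_fin : (mu setT < +oo)%E) (mu_sigma : mle mu sigma).
Hypotheses (A0 : A !=set0) (cA : closed A).
Hypotheses (muA : mu (~` A) = 0%E).
Hypothesis sigma_fin : forall x, A x -> potential alpha sigma x \is a fin_num.
Hypothesis sigma_cont : {within A, continuous (potential alpha sigma)}.

Lemma potential_ge0 (nu : bmeasure R n) x : (0 <= potential alpha nu x)%E.
Proof. by apply: integral_ge0 => y _; exact: riesz_ge0. Qed.

Let sigmaE x : (potential alpha sigma x =
  potential alpha mu x + potential alpha (mdiff sigma mu) x)%E.
Proof.
rewrite /potential -ge0_integral_measure_add//.
- apply: eq_measure_integral => B mB _.
  rewrite -[RHS]/(measure_add mu (mdiff sigma mu) B) measure_addE; apply: mdiffE => //.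
  by apply: le_lt_trans mu_fin; apply: le_measure; rewrite ?inE.
- by move=> y _; exact: riesz_ge0.
- exact: measurable_riesz.
Qed.

(** On [A] the potential is dominated by that of [sigma]; off [A] the kernel is bounded on [A] by
    the distance, and [mu] is finite and carried by [A]. *)
Lemma potential_fin_num x : potential alpha mu x \is a fin_num.
Proof.
rewrite ge0_fin_numE ?potential_ge0//; have [Ax|Ax] := pselect (A x).
  have := sigma_fin Ax; rewrite ge0_fin_numE ?potential_ge0// sigmaE.
  by apply: le_lt_trans; rewrite leeDl// potential_ge0.
have [e e0 he] := closed_sqn_gap cA Ax.
have mA : measurable (A : set (Rn R n)) by exact: closed_Rn_measurable.
rewrite /potential (ge0_integral_conull mA)//; last 2 first.
- exact: measurable_riesz.
- by move=> y; exact: riesz_ge0.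
apply: (@le_lt_trans _ _ (\int[mu]_(y in A) (rprofile n alpha e))%E).
  apply: ge0_le_integral => //.
  - by move=> y _; exact: riesz_ge0.
  - by apply: measurable_funTS; exact: measurable_riesz.
  - by move=> y Ay; rewrite rieszE; apply: rprofile_anti; [|exact: ltW|exact: he].
rewrite integral_cst//= {1}/rprofile gt_eqF// lte_mul_pinfty ?lee_fin ?powR_ge0//.
by apply: le_lt_trans mu_fin; apply: le_measure; rewrite ?inE.
Qed.

(** The potential of [sigma] is the sum of those of [mu] and [mdiff sigma mu]. Fatou bounds both
    from below in the limit, so convergence of the sum bounds the first from above. *)
Let potential_cvg_on (u : nat -> 'rV[R]_n) x : (forall k, A (u k)) -> A x ->
  u k @[k --> \oo] --> x ->
  potential alpha mu (u k) @[k --> \oo] --> potential alpha mu x.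
Proof.
move=> Au Ax ux.
have cs : potential alpha sigma (u k) @[k --> \oo] --> potential alpha sigma x.
  move=> U hU.
  have h := (subspace_continuousP _ _).1 sigma_cont x Ax U hU.
  have h2 : \forall k \near \oo, A (u k) -> U (potential alpha sigma (u k)).
    exact: (ux _ h).
  by apply: filterS h2 => k; apply; exact: Au.
have lo (nu : bmeasure R n) a : (a < potential alpha nu x)%E ->
    \forall k \near \oo, (a < potential alpha nu (u k))%E.
  apply: fatou_near => //.
  - by move=> k; exact: measurable_riesz.
  - by move=> k y _; exact: riesz_ge0.
  - by move=> y _; exact: riesz_cvg.
have mf := potential_fin_num x.
have df : potential alpha (mdiff sigma mu) x \is a fin_num.
  by have := sigma_fin Ax; rewrite sigmaE fin_numD => /andP[].
have sf := sigma_fin Ax.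
set a := potential alpha mu x in mf *.
set b := potential alpha (mdiff sigma mu) x in df *.
have ea : a = (fine a)%:E by rewrite fineK.
have eb : b = (fine b)%:E by rewrite fineK.
rewrite ea; apply/fine_cvgP; split.
  by apply: nearW => k; exact: potential_fin_num.
apply/cvgrPdist_lt => e e0; have e20 : (0 < e / 2)%R by rewrite divr_gt0.
have h1 : \forall k \near \oo, ((fine a - e)%:E < potential alpha mu (u k))%E.
  by apply: lo; rewrite -/a ea lte_fin ltrBlDr ltrDl.
have h2 : \forall k \near \oo,
    ((fine b - e / 2)%:E < potential alpha (mdiff sigma mu) (u k))%E.
  by apply: lo; rewrite -/b eb lte_fin ltrBlDr ltrDl.
have h3 : \forall k \near \oo,
    (potential alpha sigma (u k) < (fine a + fine b + e / 2)%:E)%E.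
  move: cs; rewrite (sigmaE x) -/a -/b ea eb -EFinD.
  move=> /fine_cvgP[hf /cvgrPdist_lt /(_ _ e20)].
  apply: filterS2 hf => k hk; rewrite /= ltr_distl => /andP[l1 l2].
  by rewrite -[ltLHS]fineK// lte_fin; lra.
apply: filterS3 h1 h2 h3 => k; rewrite sigmaE /=.
have := potential_fin_num (u k).
case: (potential alpha mu (u k)) => [p| |] // _.
have := potential_ge0 (mdiff sigma mu) (u k).
case: (potential alpha (mdiff sigma mu) (u k)) => [q| |] // _.
rewrite -EFinD !lte_fin /= => l1 l2 l3.
by rewrite ltr_distl; apply/andP; split; lra.
Qed.

(** An atom at [x] would make the potential infinite there. *)
Let point_null x : A x -> mu [set x] = 0%E.
Proof.
move=> Ax; apply/eqP; rewrite eq_le measure_ge0 andbT leNgt; apply/negP => x0.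
have mx : measurable ([set x] : set (Rn R n)).
  exact: measurable_Rn_set1.
have := potential_fin_num x; rewrite ge0_fin_numE ?potential_ge0//.
apply/negP; rewrite -leNgt leye_eq.
have : (\int[mu]_(y in [set x]) riesz alpha x y <= potential alpha mu x)%E.
  apply: ge0_subset_integral => //; first exact: measurable_riesz.
  by move=> y _; exact: riesz_ge0.
rewrite (eq_integral (cst +oo%E)); last first.
  by move=> y; rewrite inE => ->; rewrite /riesz eqxx.
by rewrite integral_cst//= gt0_mulye// leye_eq.
Qed.

(* If u' is an almost nearest point of A to u, then |u' - y| <= C |u - y| on A,
   so the kernel at u is dominated by a multiple of the kernel at u', and the
   potentials converge along points of A. *)
Let potential_cvg_in (u : nat -> 'rV[R]_n) x : A x ->
  u k @[k --> \oo] --> x ->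
  potential alpha mu (u k) @[k --> \oo] --> potential alpha mu x.
Proof.
move=> Ax ux.
have /choice[u' hu'] : forall k, exists x',
    A x' /\ forall y, A y -> sqn (u k - x') <= 4 * sqn (u k - y).
  by move=> k; have [x' Ax' hx'] := near_projection (u k) cA A0; exists x'.
have Au' k : A (u' k) by have [] := hu' k.
have u'x : u' k @[k --> \oo] --> x.
  apply: cvg_sqn.
  (* As [x] lies in [A], [|u' - x|^2 <= 2 |u' - u|^2 + 2 |u - x|^2 <= (8 + 2) |u - x|^2]. *)
  have s0 : 10 * sqn (u k - x) @[k --> \oo] --> 0.
    rewrite -[X in _ --> X](mulr0 10); apply: cvgM; first exact: cvg_cst.
    by have := @sqn_cvg _ _ _ \oo eventually_filter u x x ux; rewrite subrr sqn0.
  apply: (squeeze_cvgr _ (cvg_cst 0) s0); apply: nearW => k.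
  rewrite sqn_ge0 /=; apply: le_trans (sqn_sub_le _ (u k) _) _.
  by rewrite sqnBC; have := (hu' k).2 x Ax; lra.
(* Removing the null point [x] makes the limiting majorant finite everywhere on the domain. *)
pose D : set (Rn R n) := A `\ x.
have mA : measurable (A : set (Rn R n)) by exact: closed_Rn_measurable.
have mx : measurable ([set x] : set (Rn R n)).
  exact: measurable_Rn_set1.
have mD : measurable D by exact: measurableD.
have D0 : mu (~` D) = 0%E.
  have mAC : measurable (~` A : set (Rn R n)) by exact: measurableC.
  apply: (@subset_measure0 _ _ _ mu (~` D) (~` A `|` [set x])).
  - exact: measurableC.
  - exact: measurableU.
  - move=> y /= /not_andP[nA|nx]; [by left|right].
    exact: contrapT.
  - exact: (@null_set_setU _ _ _ mu _ _ mAC mx muA (point_null Ax)).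
have potE z : potential alpha mu z = (\int[mu]_(y in D) riesz alpha z y)%E.
  apply: ge0_integral_conull => //; first exact: measurable_riesz.
  by move=> y; exact: riesz_ge0.
(* This is 10 to the power [riesz_exp]: likewise [|u' - y|^2 <= 10 |u - y|^2] for [y] in [A], so the
   kernel at [u] is at most [c] times the kernel at [u']. *)
pose c : R := (10^-1) `^ (- riesz_exp n alpha).
have c0 : 0 < c by rewrite powR_gt0// invr_gt0.
rewrite potE; under eq_fun do rewrite potE.
apply: (@pratt _ _ _ _ D _ (fun k y => (c%:E * riesz alpha (u' k) y)%E)
   _ (fun y => (c%:E * riesz alpha x y)%E)) => //.
- by move=> k; apply: measurable_funTS; exact: measurable_riesz.
- move=> k; apply: measurable_funTS; apply: measurable_funeM.
  exact: measurable_riesz.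
- move=> k y [Ay _]; rewrite riesz_ge0//= !rieszE -rprofileM ?sqn_ge0// ?invr_gt0//.
  apply: rprofile_anti => //; first by rewrite mulr_ge0 ?invr_ge0 ?sqn_ge0.
  have := sqn_sub_le (u' k) (u k) y; rewrite (sqnBC (u' k) (u k)).
  by have := (hu' k).2 y Ay; lra.
- by move=> y _; exact: riesz_cvg.
- by move=> y _; apply: cvgeZl => //; exact: riesz_cvg.
- move=> y [_ /= yx]; rewrite /riesz; case: eqP => [xy|_]; first by case: yx.
  by rewrite -EFinM ltry.
- by apply: measurable_funTS; exact: measurable_riesz.
- apply: measurable_funTS; apply: measurable_funeM; exact: measurable_riesz.
- rewrite ge0_integralZl//; last 3 first.
  + by apply: measurable_funTS; exact: measurable_riesz.
  + by move=> y _; exact: riesz_ge0.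
  + by rewrite lee_fin ltW.
  by rewrite -potE lte_mul_pinfty ?lee_fin ?ltW// -ge0_fin_numE
    ?potential_ge0 ?potential_fin_num.
- have iE z : (\int[mu]_(y in D) (c%:E * riesz alpha z y) =
      c%:E * potential alpha mu z)%E.
    rewrite ge0_integralZl// -?potE//.
    + by apply: measurable_funTS; exact: measurable_riesz.
    + by move=> y _; exact: riesz_ge0.
    + by rewrite lee_fin ltW.
  rewrite iE; under eq_fun do rewrite iE.
  by apply: cvgeZl => //; exact: potential_cvg_on.
Qed.

Let potential_cvg_out (u : nat -> 'rV[R]_n) x : ~ A x ->
  u k @[k --> \oo] --> x ->
  potential alpha mu (u k) @[k --> \oo] --> potential alpha mu x.
Proof.
move=> Ax ux; have [e e0 he] := closed_sqn_gap cA Ax.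
have mA : measurable (A : set (Rn R n)) by exact: closed_Rn_measurable.
have potE z : potential alpha mu z = (\int[mu]_(y in A) riesz alpha z y)%E.
  apply: ge0_integral_conull => //; first exact: measurable_riesz.
  by move=> y; exact: riesz_ge0.
(* Once [|u - x|^2 < e/4], the bound [e <= |x - y|^2 <= 2 |x - u|^2 + 2 |u - y|^2] leaves
   [|u - y|^2 >= e/4] on [A], whence a constant majorant. *)
have e40 : 0 < e / 4 by rewrite divr_gt0.
have [N _ hN] : \forall k \near \oo, sqn (u k - x) < e / 4.
  have := @sqn_cvg _ _ _ \oo eventually_filter u x x ux; rewrite subrr sqn0.
  move=> /cvgrPdist_lt /(_ _ e40); apply: filterS => k.
  by rewrite sub0r normrN ger0_norm ?sqn_ge0.
(* [pratt] asks for domination at every index, so the sequence is read from [N] on. *)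
suff : (\int[mu]_(y in A) riesz alpha (u (k + N)%N) y)%E @[k --> \oo] -->
    (\int[mu]_(y in A) riesz alpha x y)%E.
  move=> h; rewrite -(cvg_shiftn N (fun k => potential alpha mu (u k))) (potE x).
  by rewrite (_ : (fun k => _) =
    (fun k => \int[mu]_(y in A) riesz alpha (u (k + N)%N) y)%E);
    [exact: h|apply/funext => k; exact: potE].
apply: (@pratt _ _ _ mu A (fun k y => riesz alpha (u (k + N)%N) y)
  (fun=> cst (rprofile n alpha (e / 4))) (riesz alpha x)
  (cst (rprofile n alpha (e / 4)))) => //.
- by move=> k; apply: measurable_funTS; exact: measurable_riesz.
- move=> k y Ay; rewrite riesz_ge0//= rieszE.
  apply: rprofile_anti => //; first exact: ltW.
  have := sqn_sub_le x (u (k + N)%N) y; rewrite (sqnBC x (u (k + N)%N)).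
  by have := he y Ay; have := hN (k + N)%N (leq_addl _ _); lra.
- by move=> y _; apply: riesz_cvg => //; rewrite (cvg_shiftn N u).
- by move=> y _; exact: cvg_cst.
- by move=> y _; rewrite /rprofile gt_eqF// ltry.
- by apply: measurable_funTS; exact: measurable_riesz.
- rewrite integral_cst//= {1}/rprofile gt_eqF// lte_mul_pinfty ?lee_fin ?powR_ge0//.
  by apply: le_lt_trans mu_fin; apply: le_measure; rewrite ?inE.
- exact: cvg_cst.
Qed.

Lemma potential_cvg (u : nat -> 'rV[R]_n) x :
  u k @[k --> \oo] --> x ->
  potential alpha mu (u k) @[k --> \oo] --> potential alpha mu x.
Proof.
by have [Ax|Ax] := pselect (A x); [exact: potential_cvg_in|exact: potential_cvg_out].
Qed.

End potential_continuity.

(** * Restrictions and mixtures of measures, and their energies *)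

Section measure_operations.
Context d (T : measurableType d) (R : realType).
Implicit Types m : {measure set T -> \bar R}.
Local Open Scope ereal_scope.

Lemma ge0_integral_mrestr m (D : set T) (mD : measurable D) (h : T -> \bar R) :
  measurable_fun setT h -> (forall x, 0 <= h x) ->
  \int[mrestr m mD]_x h x = \int[m]_(x in D) h x.
Proof.
move=> mh h0; rewrite (ge0_integral_conull mD)//.
  apply: eq_measure_integral => B mB BD.
  by rewrite /= /mrestr setIidl.
by rewrite /= /mrestr setICl measure0.
Qed.

Lemma le_mrestr m (D : set T) (mD : measurable D) (B : set T) :
  measurable B -> mrestr m mD B <= m B.
Proof.
by move=> mB; apply: le_measure; rewrite ?inE//; exact: measurableI.
Qed.

(** Nonnegative weights keep this a measure; removing part of a measure is expressed by splitting it
    into restrictions and lowering one weight. *)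
Definition mix (a b : {nonneg R}) m1 m2 : {measure set T -> \bar R} :=
  measure_add (mscale a m1) (mscale b m2).

Lemma mixE a b m1 m2 B : mix a b m1 m2 B = a%:num%:E * m1 B + b%:num%:E * m2 B.
Proof. exact: measure_addE. Qed.

Lemma ge0_integral_mix a b m1 m2 (h : T -> \bar R) :
  measurable_fun setT h -> (forall x, 0 <= h x) ->
  \int[mix a b m1 m2]_x h x =
  a%:num%:E * \int[m1]_x h x + b%:num%:E * \int[m2]_x h x.
Proof.
by move=> mh h0; rewrite ge0_integral_measure_add// !ge0_integral_mscale.
Qed.

End measure_operations.

Section energy_operations.
Context {R : realType} (n : nat) (alpha : R).
Hypothesis alpha_ltn : alpha < n%:R.
Implicit Types (m k : bmeasure R n).
Local Open Scope ereal_scope.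

Lemma measurable_potential m : m setT < +oo ->
  measurable_fun setT (potential alpha m : Rn R n -> \bar R).
Proof.
move=> mT; apply: (@measurable_fun_fubini_tonelli_F _ _ _ _ R (fmeas mT)
  (fun z : Rn R n * Rn R n => riesz alpha (z.1 : 'rV[R]_n) z.2)).
- exact: measurable_riesz2.
- by move=> z; exact: riesz_ge0.
Qed.

Lemma mle_setT m k : mle m k -> k setT < +oo -> m setT < +oo.
Proof. by move=> mk; apply: le_lt_trans; exact: mk. Qed.

Lemma le_mle_integral m k (h : Rn R n -> \bar R) : mle m k ->
  measurable_fun setT h -> (forall x, 0 <= h x) ->
  \int[m]_x h x <= \int[k]_x h x.
Proof. by move=> mk mh h0; apply: ge0_le_measure_integral. Qed.

Lemma le_mle_energy m k : mle m k -> k setT < +oo ->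
  energy alpha m m <= energy alpha k k.
Proof.
move=> mk kT; have mT := mle_setT mk kT.
apply: (@le_trans _ _ (energy alpha m k)).
  apply: ge0_le_integral => //.
  - by move=> x _; exact: potential_ge0.
  - exact: measurable_potential.
  - exact: measurable_potential.
  - move=> x _; apply: le_mle_integral => //; first exact: measurable_riesz.
    by move=> y; exact: riesz_ge0.
apply: le_mle_integral => //; first exact: measurable_potential.
by move=> x; exact: potential_ge0.
Qed.

Lemma potential_mix a b m1 m2 x : potential alpha (mix a b m1 m2) x =
  a%:num%:E * potential alpha m1 x + b%:num%:E * potential alpha m2 x.
Proof.
apply: ge0_integral_mix; first exact: measurable_riesz.
by move=> y; exact: riesz_ge0.
Qed.

Lemma energy_mixl a b m1 m2 k : k setT < +oo -> energy alpha (mix a b m1 m2) k =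
  a%:num%:E * energy alpha m1 k + b%:num%:E * energy alpha m2 k.
Proof.
move=> kT; apply: ge0_integral_mix; first exact: measurable_potential.
by move=> y; exact: potential_ge0.
Qed.

Lemma energy_mixr a b m1 m2 k : m1 setT < +oo -> m2 setT < +oo ->
  energy alpha k (mix a b m1 m2) =
  a%:num%:E * energy alpha k m1 + b%:num%:E * energy alpha k m2.
Proof.
move=> m1T m2T; rewrite /energy.
under eq_integral do rewrite potential_mix.
have mp1 := measurable_potential m1T; have mp2 := measurable_potential m2T.
rewrite ge0_integralD//.
- rewrite !ge0_integralZl//; try by rewrite lee_fin.
  + by move=> x _; exact: potential_ge0.
  + by move=> x _; exact: potential_ge0.
- by move=> x _; rewrite mule_ge0 ?lee_fin// potential_ge0.
- exact: measurable_funeM.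
- by move=> x _; rewrite mule_ge0 ?lee_fin// potential_ge0.
- exact: measurable_funeM.
Qed.

Lemma mix_setT a b m1 m2 : m1 setT < +oo -> m2 setT < +oo ->
  mix a b m1 m2 setT < +oo.
Proof.
by move=> ? ?; rewrite mixE lte_add_pinfty// lte_mul_pinfty// lee_fin.
Qed.

Lemma finite_energyC m k : m setT < +oo -> k setT < +oo ->
  energy alpha m k = energy alpha k m.
Proof. by move=> mT kT; exact: (@energyC _ _ alpha (fmeas mT) (fmeas kT)). Qed.

Lemma finite_energy_mutual m k : m setT < +oo -> k setT < +oo ->
  energy alpha m m < +oo -> energy alpha k k < +oo ->
  energy alpha m k \is a fin_num.
Proof.
move=> mT kT em ek; rewrite ge0_fin_numE ?energy_ge0//.
exact: (@energy_mutual_lty _ _ _ alpha_ltn (fmeas mT) (fmeas kT)).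
Qed.

Lemma finite_energy_form (J : finType) (c : J -> R) (m : J -> bmeasure R n) :
  (forall p, m p setT < +oo) -> (forall p, energy alpha (m p) (m p) < +oo) ->
  (0 <= \sum_p \sum_q c p * c q * fine (energy alpha (m p) (m q)))%R.
Proof.
move=> mT me.
apply: (@energy_form_ge0 _ _ _ alpha_ltn J c (fun p => fmeas (mT p))) => p q.
have := finite_energy_mutual (mT p) (mT q) (me p) (me q).
by rewrite ge0_fin_numE ?energy_ge0.
Qed.

End energy_operations.

(** * The Gauss functional *)

Section gauss_functional.
Context {R : realType} (n : nat) (alpha : R) (I : finType).
Hypothesis alpha_ltn : alpha < n%:R.
Variables (s : I -> R) (f : I -> 'rV[R]_n -> \bar R).
Hypothesis mf : forall i, measurable_fun setT (f i : Rn R n -> \bar R).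
Hypothesis f0 : forall i x, (0 <= f i x)%E.
Implicit Types (m k : bmeasure R n) (mu nu lam : I -> bmeasure R n).

(** On such measures every term of the Gauss functional is a real number, so the functional can be
    treated as a real quadratic polynomial. *)
Definition tame i m : Prop :=
  [/\ (m setT < +oo)%E, (energy alpha m m < +oo)%E & (\int[m]_x f i x < +oo)%E].

Lemma tame_mle i m k : mle m k -> tame i k -> tame i m.
Proof.
move=> mk [kT ek fk]; split.
- exact: mle_setT kT.
- by apply: le_lt_trans ek; exact: le_mle_energy.
- by apply: le_lt_trans fk; exact: le_mle_integral.
Qed.

Lemma tame_energy i j m k : tame i m -> tame j k -> energy alpha m k \is a fin_num.
Proof. by move=> [? ? _] [? ? _]; exact: finite_energy_mutual. Qed.

Lemma tame_field i m : tame i m -> (\int[m]_x f i x)%E \is a fin_num.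
Proof. by move=> [_ _ ?]; rewrite ge0_fin_numE// integral_ge0. Qed.

Lemma tame_mix i a b m k : tame i m -> tame i k -> tame i (mix a b m k).
Proof.
move=> tm tk; have [mT em fm] := tm; have [kT ek fk] := tk.
have T := mix_setT a b mT kT; split => //.
  rewrite energy_mixl// !energy_mixr//.
  rewrite -ge0_fin_numE; last first.
    by rewrite adde_ge0// mule_ge0 ?lee_fin// adde_ge0// mule_ge0 ?lee_fin// energy_ge0.
  by rewrite !fin_numD !fin_numM ?fin_numD ?fin_numM//;
    apply: tame_energy; eassumption.
rewrite ge0_integral_mix//.
by rewrite lte_add_pinfty// lte_mul_pinfty ?lee_fin.
Qed.

(* The integral of the i-th weighted potential of [lam] against [m], see
   [integral_wpotential]. *)
Definition linf lam i m : R :=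
  \sum_j s i * s j * fine (energy alpha m (lam j)) + fine (\int[m]_x f i x)%E.

Lemma linf_mix lam i a b m k : (forall j, tame j (lam j)) ->
  tame i m -> tame i k ->
  linf lam i (mix a b m k) = a%:num * linf lam i m + b%:num * linf lam i k.
Proof.
move=> tl tm tk; rewrite /linf ge0_integral_mix//.
rewrite fineD ?fin_numM ?tame_field// !fineM ?tame_field//=.
rewrite !mulrDr addrACA; congr (_ + _); rewrite !mulr_sumr -big_split/=.
apply: eq_bigr => j _; have [lT _ _] := tl j.
rewrite energy_mixl//.
have em := tame_energy tm (tl j); have ek := tame_energy tk (tl j).
by rewrite fineD ?fin_numM// !fineM//=; ring.
Qed.

Definition bil mu nu : R :=
  \sum_i \sum_j s i * s j * fine (energy alpha (mu i) (nu j)).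

Definition field_energy mu : R := \sum_i fine (\int[mu i]_x f i x)%E.

Lemma gauss_tame mu : (forall i, tame i (mu i)) ->
  gauss alpha s f mu = (bil mu mu + 2 * field_energy mu)%:E.
Proof.
move=> tm; rewrite /gauss [in RHS]EFinD [in RHS]EFinM /venergy /bil
  /field_energy; congr (_ + _ * _)%E.
  rewrite -sumEFin; apply: eq_bigr => i _; rewrite -sumEFin.
  by apply: eq_bigr => j _; rewrite [in RHS]EFinM fineK// (tame_energy (tm i) (tm j)).
rewrite -sumEFin; apply: eq_bigr => i _.
by rewrite fineK// tame_field.
Qed.

Lemma bilC mu nu : (forall i, tame i (mu i)) -> (forall i, tame i (nu i)) ->
  bil mu nu = bil nu mu.
Proof.
move=> tm tn; rewrite /bil exchange_big/=; apply: eq_bigr => i _.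
apply: eq_bigr => j _; have [? _ _] := tm j; have [? _ _] := tn i.
by rewrite finite_energyC// [s j * _]mulrC.
Qed.

Lemma sum_linf lam mu : \sum_i linf lam i (mu i) = bil mu lam + field_energy mu.
Proof. by rewrite big_split. Qed.

Definition vmix (a b : {nonneg R}) mu nu : I -> bmeasure R n :=
  fun i => mix a b (mu i) (nu i).

Lemma field_vmix a b mu nu : (forall i, tame i (mu i)) -> (forall i, tame i (nu i)) ->
  field_energy (vmix a b mu nu) = a%:num * field_energy mu + b%:num * field_energy nu.
Proof.
move=> tm tn; rewrite /field_energy !mulr_sumr -big_split/=; apply: eq_bigr => i _.
by rewrite ge0_integral_mix// fineD ?fin_numM ?tame_field// !fineM ?tame_field.
Qed.

Lemma bil_vmixl a b mu nu lam : (forall i, tame i (mu i)) ->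
  (forall i, tame i (nu i)) -> (forall i, tame i (lam i)) ->
  bil (vmix a b mu nu) lam = a%:num * bil mu lam + b%:num * bil nu lam.
Proof.
move=> tm tn tl; have e mu' := sum_linf lam mu'.
have : \sum_i linf lam i (vmix a b mu nu i) =
    a%:num * (\sum_i linf lam i (mu i)) + b%:num * \sum_i linf lam i (nu i).
  by rewrite !mulr_sumr -big_split/=; apply: eq_bigr => i _; exact: linf_mix.
by rewrite !e field_vmix// !mulrDr addrACA => /addIr.
Qed.

Lemma tame_vmix a b mu nu : (forall i, tame i (mu i)) -> (forall i, tame i (nu i)) ->
  forall i, tame i (vmix a b mu nu i).
Proof. by move=> tm tn i; exact: tame_mix. Qed.

Lemma bil_vmix a b mu nu : (forall i, tame i (mu i)) -> (forall i, tame i (nu i)) ->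
  bil (vmix a b mu nu) (vmix a b mu nu) =
  a%:num ^+ 2 * bil mu mu + 2 * a%:num * b%:num * bil nu mu + b%:num ^+ 2 * bil nu nu.
Proof.
move=> tm tn; have tv := tame_vmix a b tm tn.
rewrite bil_vmixl// !(bilC _ tv)// !bil_vmixl// (bilC tm tn); ring.
Qed.

(** The form of mu - nu, obtained from the positive family indexed by pairs in [I * bool] with
    weight [s i] on the component of mu and [- s i] on that of nu. *)
Lemma bil_form_ge0 mu nu : (forall i, tame i (mu i)) -> (forall i, tame i (nu i)) ->
  0 <= bil mu mu - 2 * bil mu nu + bil nu nu.
Proof.
move=> tm tn.
pose m (p : I * bool) := if p.2 then mu p.1 else nu p.1.
pose c (p : I * bool) := if p.2 then s p.1 else - s p.1.
have tmn p : (m p setT < +oo)%E /\ (energy alpha (m p) (m p) < +oo)%E.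
  by rewrite /m; case: p.2; [have [? ? _] := tm p.1|have [? ? _] := tn p.1].
have := finite_energy_form alpha_ltn c (fun p => (tmn p).1) (fun p => (tmn p).2).
rewrite (_ : \sum_p _ = bil mu mu - bil mu nu - bil nu mu + bil nu nu).
  by rewrite (bilC tn tm) -mulr_natl; lra.
rewrite /bil -!sumrN -!big_split/= -(pair_bigA _ (fun i b => \sum_q c (i, b) * c q *
  fine (energy alpha (m (i, b)) (m q)))) /=.
apply: eq_bigr => i _; rewrite -!sumrN -!big_split/= big_bool/=.
rewrite -(pair_bigA _ (fun j b => c (i, true) * c (j, b) *
  fine (energy alpha (m (i, true)) (m (j, b))))) /=.
rewrite -(pair_bigA _ (fun j b => c (i, false) * c (j, b) *
  fine (energy alpha (m (i, false)) (m (j, b))))) /=.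
rewrite -big_split/=; apply: eq_bigr => j _.
by rewrite !big_bool /m /c /=; ring.
Qed.

(** The right side minus the left is exactly the form of mu - lam. *)
Lemma gauss_convex lam mu : (forall i, tame i (lam i)) -> (forall i, tame i (mu i)) ->
  (bil lam lam + 2 * field_energy lam) +
    2 * (\sum_i linf lam i (mu i) - \sum_i linf lam i (lam i)) <=
  bil mu mu + 2 * field_energy mu.
Proof. by move=> tl tm; rewrite !sum_linf; have := bil_form_ge0 tm tl; lra. Qed.

(* The derivative of the Gauss functional at [lam] towards [nu] is
   2 (linf lam nu - linf lam lam). *)
Lemma gauss_min_linf lam nu : (forall i, tame i (lam i)) -> (forall i, tame i (nu i)) ->
  (forall t : R, forall (t0 : 0 <= t) (t1 : 0 <= 1 - t),
    bil lam lam + 2 * field_energy lam <=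
    bil (vmix (NngNum t1) (NngNum t0) lam nu) (vmix (NngNum t1) (NngNum t0) lam nu) +
    2 * field_energy (vmix (NngNum t1) (NngNum t0) lam nu)) ->
  \sum_i linf lam i (lam i) <= \sum_i linf lam i (nu i).
Proof.
move=> tl tn h; rewrite leNgt; apply/negP; rewrite -subr_gt0.
set D := _ - _ => D0.
set Q := bil lam lam - 2 * bil nu lam + bil nu nu.
have Q0 : 0 <= Q.
  by have := bil_form_ge0 tl tn; rewrite /Q (bilC tn tl); lra.
have h' t : 0 <= t -> 0 <= 1 - t -> 2 * t * D <= t ^+ 2 * Q.
  move=> t0 t1; have := h t t0 t1.
  rewrite bil_vmix// field_vmix//= /D /Q !sum_linf; lra.
(* Divided by [t], [h'] would give [2 D <= t Q], whereas this [t] satisfies [t Q = D - t D < D]. The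
   summand [D] in the denominator covers [Q = 0] and keeps [t <= 1]. *)
pose t := D / (D + Q).
have DQ : 0 < D + Q by lra.
have t0 : 0 < t by rewrite divr_gt0.
have t1 : 0 <= 1 - t by rewrite subr_ge0 ler_pdivrMr// mul1r; lra.
have := h' t (ltW t0) t1.
have e : t * (D + Q) = D by rewrite /t divfK// gt_eqF.
nra.
Qed.

Lemma integral_wpotential lam i m : (forall j, tame j (lam j)) -> tame i m ->
  m.-integrable setT (wpotential alpha s f lam i : Rn R n -> \bar R) /\
  (\int[m]_x wpotential alpha s f lam i x = (linf lam i m)%:E)%E.
Proof.
move=> tl tm.
have ip j : m.-integrable setT (potential alpha (lam j) : Rn R n -> \bar R).
  have [lT _ _] := tl j; apply/integrableP; split.
    exact: measurable_potential.
  under eq_integral do rewrite gee0_abs ?potential_ge0//.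
  by rewrite -ge0_fin_numE ?integral_ge0//; [exact: tame_energy tm (tl j)|
    move=> x _; exact: potential_ge0].
have iz j : m.-integrable setT
    (fun x : Rn R n => ((s i * s j)%:E * potential alpha (lam j) x)%E).
  by apply: integrableZl.
have i_f : m.-integrable setT (f i : Rn R n -> \bar R).
  apply/integrableP; split => //.
  by under eq_integral do rewrite gee0_abs//; have [] := tm.
have is_ : m.-integrable setT (fun x : Rn R n =>
    (\sum_j (s i * s j)%:E * potential alpha (lam j) x)%E).
  by apply: integrable_sum.
split; first exact: integrableD.
rewrite /wpotential integralD// integral_sum// /linf EFinD.
congr (_ + _)%E; last by rewrite fineK// tame_field.
rewrite -sumEFin; apply: eq_bigr => j _.
by rewrite integralZl// [in RHS]EFinM fineK// (tame_energy tm (tl j)).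
Qed.

End gauss_functional.

(** * Comparing integrals of one function against two measures *)

Section integral_comparison.
Context d (T : measurableType d) (R : realType).
Implicit Types m k : {measure set T -> \bar R}.
Local Open Scope ereal_scope.

Lemma bigcup_gt0 m (F : nat -> set T) : (forall j, measurable (F j)) ->
  0 < m (\bigcup_j F j) -> exists j, 0 < m (F j).
Proof.
move=> mF; apply: contraPP => /forallNP h; apply/negP; rewrite -leNgt.
suff -> : m (\bigcup_j F j) = 0 by [].
apply/negligibleP; first exact: bigcup_measurable.
apply: negligible_bigcup => j; apply/negligibleP => //.
by apply/eqP; rewrite eq_le measure_ge0 andbT leNgt; apply/negP; exact: h.
Qed.

Lemma le_integral_conull m (D : set T) (h1 h2 : T -> \bar R) :
  measurable D -> m (~` D) = 0 -> m.-integrable setT h1 -> m.-integrable setT h2 ->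
  (forall x, D x -> h1 x <= h2 x) -> \int[m]_x h1 x <= \int[m]_x h2 x.
Proof.
move=> mD D0 i1 i2 h12.
have mDC : measurable (~` D) by exact: measurableC.
rewrite (negligible_integral mDC _ i1)// (negligible_integral mDC _ i2)//.
rewrite setTD setCK; apply: le_integral => //.
- exact: (integrableS measurableT).
- exact: (integrableS measurableT).
- by move=> x /[!inE]; exact: h12.
Qed.

(** Under [m] the function has no positive part. Its negative part under [k] lives on [N], where
    [k <= m], so it integrates to no more than under [m]. *)
Lemma le_integral_exchange m k (S D N : set T) (h : T -> \bar R) :
  measurable S -> measurable D -> measurable N ->
  m (~` S) = 0 -> k (~` D) = 0 ->
  m.-integrable setT h -> k.-integrable setT h ->
  (forall x, S x -> h x <= 0) -> (forall x, D x -> ~ N x -> 0 <= h x) ->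
  (forall B, measurable B -> B `<=` N -> k B <= m B) ->
  \int[m]_x h x <= \int[k]_x h x.
Proof.
move=> mS mD mN mS0 kD0 im ik hS hD kmN.
have mh : measurable_fun setT h by exact: measurable_int im.
have mhp : measurable_fun setT h^\+ by exact: measurable_funepos.
have mhn : measurable_fun setT h^\- by exact: measurable_funeneg.
rewrite integralE [leRHS]integralE.
have -> : \int[m]_x h^\+ x = 0.
  rewrite (ge0_integral_conull mS)//; apply: integral0_eq => x Sx.
  by rewrite funeposE; apply/max_idPr; exact: hS.
have : \int[k]_x h^\- x <= \int[m]_x h^\- x.
  apply: (@le_trans _ _ (\int[k]_(x in N) h^\- x)).
    rewrite (ge0_integral_conull mD)// [leRHS]integral_mkcond.
    apply: (@le_trans _ _ (\int[k]_(x in D) (h^\- \_ N) x)).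
      apply: ge0_le_integral => //.
      - exact: measurable_funTS.
      - by apply: measurable_funTS; apply/(measurable_restrictT _ mN)/measurable_funTS.
      - move=> x Dx; rewrite patchE; case: ifPn => // /negP xN.
        rewrite funenegE; have -> // : maxe (- h x) 0 = 0.
        apply/max_idPr; rewrite leeNl oppe0; apply: hD => // Nx.
        by apply: xN; rewrite inE.
    apply: ge0_subset_integral => //.
      by apply/(measurable_restrictT _ mN)/measurable_funTS.
    by move=> x _; rewrite patchE; case: ifPn.
  apply: (@le_trans _ _ (\int[m]_(x in N) h^\- x)).
    rewrite -(ge0_integral_mrestr _ mN)// -(ge0_integral_mrestr _ mN)//.
    apply: ge0_le_measure_integral => // B mB; rewrite /= /mrestr.
    by apply: kmN; [exact: measurableI|exact: subIsetr].
  exact: ge0_subset_integral.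
move=> hn; rewrite add0e.
have fm : \int[m]_x h^\- x \is a fin_num.
  by apply: integrable_fin_num => //; exact: integrable_funeneg.
apply: (@le_trans _ _ (- \int[k]_x h^\- x)); first by rewrite leeN2.
by rewrite leeDr// integral_ge0.
Qed.

End integral_comparison.

Lemma closed_norm_le {R : realType} (n : nat) (c : R) :
  closed [set x : 'rV[R]_n | `|x| <= c].
Proof.
apply: (@closed_comp _ _ (fun x : 'rV[R]_n => `|x|) [set y | y <= c]).
  by move=> x _; exact: norm_continuous.
exact: closed_le.
Qed.

Lemma compact_norm_le {R : realType} (n : nat) (c : R) :
  compact [set x : 'rV[R]_n | `|x| <= c].
Proof.
apply: bounded_closed_compact; last exact: closed_norm_le.
exists c; split; first exact: num_real.
by move=> r cr x /= /le_trans; apply; exact: ltW.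
Qed.

(** * The constrained problem *)

Section constrained_problem.
Context {R : realType} (n : nat) (alpha : R) (I : finType).
Variables (A : I -> set 'rV[R]_n) (s : I -> R).
Variables (f : I -> 'rV[R]_n -> \bar R) (a : I -> R) (g : I -> 'rV[R]_n -> R).
Variables (M : I -> R) (sigma lam : I -> bmeasure R n).
Hypothesis alpha_ltn : alpha < n%:R.
Hypotheses (A_neq0 : forall i, A i !=set0) (A_closed : forall i, closed (A i)).
Hypotheses (a_gt0 : forall i, 0 < a i) (g_gt0 : forall i x, 0 < g i x).
Hypothesis g_cont : forall i, continuous (g i).
Hypothesis g_inf : forall i, 0 < inf (range (g i)).
Hypothesis g_bound : forall i x, g i x <= M i.
Hypothesis f_ge0 : forall i x, (0 <= f i x)%E.
Hypothesis f_lsc : forall i, lower_semicontinuous (f i).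
Hypothesis sigma_radon : forall i, radon (sigma i).
Hypothesis sigma_supp : forall i, msupport (sigma i) `<=` A i.
Hypothesis sigma_mass : forall i, ((a i)%:E < \int[sigma i]_x (g i x)%:E)%E.
Hypothesis sigma_fin : forall i x, A i x ->
  potential alpha (sigma i) x \is a fin_num.
Hypothesis sigma_cont : forall i,
  {within A i, continuous (potential alpha (sigma i))}.
Hypothesis sigma_field : forall i, sigma i [set x | A i x /\ f i x = +oo%E] = 0%E.
Local Notation adm := (admissible alpha A s f a g sigma).
Hypothesis lam_adm : adm lam.
Local Notation W := (wpotential alpha s f lam).
Implicit Types (m k : bmeasure R n) (mu nu : I -> bmeasure R n).

Let mA i : measurable (A i : set (Rn R n)).
Proof. exact: closed_Rn_measurable. Qed.

Let mAC i : measurable (~` A i : set (Rn R n)).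
Proof. exact: measurableC. Qed.

Let mg i : measurable_fun setT (EFin \o g i : Rn R n -> \bar R).
Proof. by apply/measurable_EFinP; exact: continuous_Rn_measurable. Qed.

Let mf i : measurable_fun setT (f i : Rn R n -> \bar R).
Proof. exact: lsc_Rn_measurable. Qed.

Let g0 i x : (0 <= (g i x)%:E)%E. Proof. by rewrite lee_fin ltW. Qed.

Lemma weighted_mass_lty i m : (\int[m]_x (g i x)%:E < +oo)%E -> (m setT < +oo)%E.
Proof.
move=> gm; have : ((inf (range (g i)))%:E * m setT < +oo)%E.
  rewrite -integral_cst//; apply: le_lt_trans gm; apply: ge0_le_integral => //.
  - by move=> x _; rewrite lee_fin ltW.
  - exact: mg.
  - move=> x _; rewrite lee_fin; apply: ge_inf; last by exists x.
    by exists 0 => _ [y _ <-]; exact: ltW.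
have := measure_ge0 m setT; case: (m setT) => [r _ _|_|//].
  by rewrite ltry.
by rewrite gt0_muley ?lte_fin.
Qed.

(** The constraints on component [i] alone. By [admissibleP] the admissible class is a product, so
    one component can be varied while the others stay fixed. *)
Definition admissible1 i m : Prop :=
  [/\ tame alpha f i m, m (~` A i) = 0%E, mle m (sigma i) &
      \int[m]_x (g i x)%:E = (a i)%:E]%E.

(** All mutual energies are finite, so [venergy] is real, and finiteness of the Gauss functional
    bounds the sum of the nonnegative field integrals. *)
Lemma admissible_tame mu : adm mu -> forall i, tame alpha f i (mu i).
Proof.
move=> [[vmu emu] gfin _ gmu].
have mT i : (mu i setT < +oo)%E by apply: (@weighted_mass_lty i); rewrite gmu ltry.
have ev : venergy alpha s mu \is a fin_num.
  apply/sum_fin_numP => i _ _; apply/sum_fin_numP => j _ _.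
  by rewrite fin_numM// finite_energy_mutual.
have F0 i : (0 <= \int[mu i]_x f i x)%E by apply: integral_ge0.
have fs : (\sum_i \int[mu i]_x f i x < +oo)%E.
  move: gfin; rewrite /gauss fin_numD ev /=.
  have : (0 <= \sum_i \int[mu i]_x f i x)%E by apply: sume_ge0.
  case: (\sum_i _)%E => [r _ _|_|//]; first by rewrite ltry.
  by rewrite gt0_muley ?lte_fin.
move=> i; split => //; apply: le_lt_trans fs.
by rewrite (bigD1 i)//= leeDl// sume_ge0.
Qed.

Lemma admissibleP mu : adm mu <-> forall i, admissible1 i (mu i).
Proof.
split=> [amu i|h].
  have tmu := admissible_tame amu; case: amu => [[vmu emu] _ smu gmu].
  by split => //; apply: msupport_sub_null => //; have [] := vmu i.
have tmu i : tame alpha f i (mu i) by have [] := h i.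
split => //.
- split=> i; last by have [] := tmu i.
  have [_ muA _ _] := h i; split; last exact: null_msupport_sub.
  move=> K cK; have [mT _ _] := tmu i; apply: le_lt_trans mT.
  apply: le_measure; rewrite ?inE//; apply: closed_Rn_measurable.
  by apply: compact_closed => //; exact: norm_hausdorff.
- by rewrite gauss_tame.
- by move=> i; have [] := h i.
- by move=> i; have [] := h i.
Qed.

Let lam1 i : admissible1 i (lam i). Proof. exact: (admissibleP lam).1. Qed.

Let lam_tame i : tame alpha f i (lam i). Proof. by have [] := lam1 i. Qed.

Let lamT i : (lam i setT < +oo)%E. Proof. by have [] := lam_tame i. Qed.

Let lam_sigma i : mle (lam i) (sigma i). Proof. by have [] := lam1 i. Qed.

Let lamA i : lam i (~` A i) = 0%E. Proof. by have [] := lam1 i. Qed.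

Let lam_fin i x : potential alpha (lam i) x \is a fin_num.
Proof.
by apply: (@potential_fin_num _ _ _ alpha_ltn _ (sigma i) (A i)) => //; exact: sigma_fin.
Qed.

Let lam_cvg i (u : nat -> 'rV[R]_n) x : u k @[k --> \oo] --> x ->
  potential alpha (lam i) (u k) @[k --> \oo] --> potential alpha (lam i) x.
Proof.
apply: (@potential_cvg _ _ _ alpha_ltn _ (sigma i) (A i)) => //; exact: sigma_fin.
Qed.

(** The real-valued, continuous part of [W i], what remains after the field is split off. *)
Let V i x : R := \sum_j s i * s j * fine (potential alpha (lam j) x).

Let WE i x : W i x = ((V i x)%:E + f i x)%E.
Proof.
rewrite /wpotential /V; congr (_ + _)%E; rewrite -sumEFin.
by apply: eq_bigr => j _; rewrite [in RHS]EFinM fineK.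
Qed.

Let V_cvg i (u : nat -> 'rV[R]_n) x : u k @[k --> \oo] --> x ->
  V i (u k) @[k --> \oo] --> V i x.
Proof.
move=> ux; rewrite /V; apply: (@cvg_sumr _ _ _ _ _ _
  (fun j t => s i * s j * fine (potential alpha (lam j) (u t)))) => j.
apply: cvgM; first exact: cvg_cst.
by apply: fine_cvg; rewrite fineK//; exact: lam_cvg.
Qed.

Let mW i : measurable_fun setT (W i : Rn R n -> \bar R).
Proof.
by have [/measurable_int] :=
  integral_wpotential alpha_ltn s mf f_ge0 lam_tame (lam_tame i).
Qed.

Let diff i : bmeasure R n := mdiff (sigma i) (lam i).

Let sigmaE i B : measurable B -> (sigma i B = lam i B + diff i B)%E.
Proof.
move=> mB; apply: mdiffE => //; first exact: lam_sigma.
by apply: le_lt_trans (lamT i); apply: le_measure; rewrite ?inE.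
Qed.

Let diff_le i B : measurable B -> (diff i B <= sigma i B)%E.
Proof. by move=> mB; rewrite sigmaE// leeDr. Qed.

Let diffA i : diff i (~` A i) = 0%E.
Proof.
apply/eqP; rewrite eq_le measure_ge0 andbT; apply: le_trans (diff_le i (mAC i)) _.
by rewrite (msupport_sub_null (A_closed (i:=i)) (sigma_supp (i:=i))).
Qed.

Lemma admissible1_mix i (t u : {nonneg R}) m k : t%:num + u%:num = 1 ->
  admissible1 i m -> admissible1 i k -> admissible1 i (mix t u m k).
Proof.
move=> tu [tm mA0 ms gm] [tk kA0 ks gk]; split.
- exact: tame_mix.
- by rewrite mixE mA0 kA0 !mule0 adde0.
- move=> B mB; rewrite mixE -[leRHS]mul1e -tu EFinD ge0_muleDl ?lee_fin//.
  by apply: leeD; apply: lee_wpmul2l; rewrite ?lee_fin//; [exact: ms|exact: ks].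
- rewrite ge0_integral_mix; [|exact: mg|exact: g0].
  by rewrite gm gk -!EFinM -EFinD -mulrDl tu mul1r.
Qed.

Let L := linf alpha s f lam.

Lemma solution_linf mu : solutions alpha A s f a g sigma lam -> adm mu ->
  \sum_i L i (lam i) <= \sum_i L i (mu i).
Proof.
move=> [_ lmin] amu; have tmu := admissible_tame amu.
apply: gauss_min_linf => // t t0 t1.
rewrite -lee_fin -!gauss_tame//; last exact: tame_vmix.
rewrite lmin; apply: ereal_inf_lbound; exists (vmix (NngNum t1) (NngNum t0) lam mu) => //.
apply/admissibleP => i; apply: admissible1_mix => //=; first by rewrite subrK.
exact: (admissibleP mu).1.
Qed.

Lemma solution_linf1 i m : solutions alpha A s f a g sigma lam ->
  admissible1 i m -> L i (lam i) <= L i m.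
Proof.
move=> sol am; pose mu j := if j == i then m else lam j.
have amu : adm mu.
  by apply/admissibleP => j; rewrite /mu; case: eqP => [->|_].
have := solution_linf sol amu.
rewrite (bigD1 i)//= [leRHS](bigD1 i)//= {1}/mu eqxx.
rewrite (eq_bigr (fun j => L j (lam j)) (P := fun j => j != i)
  (F1 := fun j => L j (mu j))); last by move=> j /negbTE ji; rewrite /mu ji.
by rewrite lerD2r.
Qed.

Lemma linf_solution : (forall mu i, adm mu -> L i (lam i) <= L i (mu i)) ->
  solutions alpha A s f a g sigma lam.
Proof.
move=> h; split => //; apply/eqP; rewrite eq_le; apply/andP; split; last first.
  by apply: ereal_inf_lbound; exists lam.
apply: le_ereal_inf_tmp => _ [mu amu <-]; have tmu := admissible_tame amu.
rewrite !gauss_tame// lee_fin.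
apply: (le_trans _ (gauss_convex alpha_ltn s lam_tame tmu)).
by rewrite lerDl mulr_ge0// subr_ge0; apply: ler_sum => i _; exact: h.
Qed.

Lemma weight_integrable i m : (\int[m]_x (g i x)%:E < +oo)%E ->
  m.-integrable setT (EFin \o g i : Rn R n -> \bar R).
Proof.
move=> gm; apply/integrableP; split => //.
rewrite (eq_integral (fun x : Rn R n => (g i x)%:E))// => x _.
by rewrite gee0_abs//; exact: g0.
Qed.

Lemma measurable_gap_lt i (w : R) :
  measurable ([set x | (W i x < (w * g i x)%:E)%E] : set (Rn R n)).
Proof.
have mwg : measurable_fun setT (fun x : Rn R n => (w * g i x)%:E).
  apply/measurable_EFinP; apply: measurable_funM => //.
  exact: continuous_Rn_measurable.
by rewrite -[X in measurable X]setTI; exact: emeasurable_fun_lt.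
Qed.

Lemma measurable_gap_gt i (w : R) :
  measurable ([set x | ((w * g i x)%:E < W i x)%E] : set (Rn R n)).
Proof.
have mwg : measurable_fun setT (fun x : Rn R n => (w * g i x)%:E).
  apply/measurable_EFinP; apply: measurable_funM => //.
  exact: continuous_Rn_measurable.
by rewrite -[X in measurable X]setTI; exact: emeasurable_fun_lt.
Qed.

Lemma variational_linf i (w : R) mu : adm mu ->
  {ae diff i, forall x, A i x -> ((w * g i x)%:E <= W i x)%E} ->
  (forall x, msupport (lam i) x -> (W i x <= (w * g i x)%:E)%E) ->
  L i (lam i) <= L i (mu i).
Proof.
move=> amu [N0 [mN0 N00 subN0]] hS.
have [tm mA0 ms gm] := (admissibleP mu).1 amu i.
have [_ _ _ gl] := lam1 i.
(* [lam i] and [mu i] have the same weighted mass [a i], so subtracting [w g_i] shifts both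
   integrals by the same [w * a i]. *)
pose h (x : Rn R n) : \bar R := (W i x - w%:E * (g i x)%:E)%E.
have hm k : tame alpha f i k -> (\int[k]_x (g i x)%:E = (a i)%:E)%E ->
    k.-integrable setT h /\ (\int[k]_x h x = (L i k - w * a i)%:E)%E.
  move=> tk gk.
  have [iW eW] := integral_wpotential alpha_ltn s mf f_ge0 lam_tame tk.
  have ig : k.-integrable setT (fun x : Rn R n => (w%:E * (g i x)%:E)%E).
    by apply: integrableZl => //; apply: weight_integrable; rewrite gk ltry.
  split; first exact: integrableB.
  rewrite integralB// eW integralZl ?gk//.
  by apply: weight_integrable; rewrite gk ltry.
have [il el] := hm _ (lam_tame i) gl; have [im em] := hm _ tm gm.
rewrite -(lerD2r (- (w * a i))) -lee_fin -el -em.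
(* By the first inequality [diff i] vanishes on [N], so there [mu i <= sigma i = lam i]. *)
pose N : set (Rn R n) := A i `&` [set x | (W i x < (w * g i x)%:E)%E].
have mN : measurable N by apply: measurableI => //; exact: measurable_gap_lt.
apply: (@le_integral_exchange _ _ _ (lam i) (mu i) (msupport (lam i)) (A i) N) => //.
- by apply: closed_Rn_measurable; exact: msupport_closed.
- exact: msupport_null.
- by move=> x Sx; rewrite /h sube_le0 -EFinM; exact: hS.
- move=> x Ax nN; rewrite /h -EFinM sube_ge0//.
  by rewrite leNgt; apply/negP => hx; apply: nN.
- move=> B mB BN; apply: (le_trans (ms B mB)); rewrite sigmaE//.
  rewrite (_ : diff i B = 0%E) ?adde0//.
  apply: (subset_measure0 mB mN0 _ N00) => x /BN[Ax Wx]; apply: subN0 => /= /(_ Ax).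
  by rewrite leNgt Wx.
Qed.

(** Two cuts. Restricting to a ball where [f i <= j] gives finite mass and field integral;
    restricting further to where the potential of this first piece is at most [l] gives finite
    energy, since the second piece has the smaller potential. As [j] and [l] grow the pieces exhaust
    [E], the potential of [sigma i] being finite on [A i]. *)
Let diff_restrict_tame i : forall E : set (Rn R n), measurable E -> E `<=` A i ->
  (0 < diff i E)%E -> (forall x, E x -> (f i x < +oo)%E) ->
  exists F : set (Rn R n), exists mF : measurable F,
    [/\ F `<=` E, (0 < diff i F)%E & tame alpha f i (mrestr (diff i) mF)].
Proof.
move=> E mE EA E0 fE.
pose D (j : nat) : set (Rn R n) := E `&`
  ([set x | `|x : 'rV[R]_n| <= j%:R] `&` [set x | (f i x <= j%:R%:E)%E]).
have mball (j : nat) : measurable ([set x | `|x : 'rV[R]_n| <= j%:R] : set (Rn R n)).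
  by apply: closed_Rn_measurable; exact: closed_norm_le.
have mD j : measurable (D j).
  apply: measurableI => //; apply: measurableI => //.
  rewrite -[X in measurable X]setTI.
  exact: emeasurable_fun_infty_c.
have [j Dj0] : exists j, (0 < diff i (D j))%E.
  apply: bigcup_gt0 => //; rewrite (_ : \bigcup_j D j = E)//.
  apply/seteqP; split => [x [j _ []]//|x Ex].
  have fx : f i x = (fine (f i x))%:E by rewrite fineK// ge0_fin_numE ?fE.
  exists (Num.truncn (`|x : 'rV[R]_n| + fine (f i x))).+1 => //.
  have f1 : 0 <= fine (f i x) by exact: fine_ge0.
  have n1 : 0 <= `|x : 'rV[R]_n| by exact: normr_ge0.
  have := truncnS_gt (`|x : 'rV[R]_n| + fine (f i x)) => h.
  by split => //; split => /=; [|rewrite fx lee_fin]; lra.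
have DjT : (diff i (D j) < +oo)%E.
  apply: le_lt_trans (@sigma_radon i _ (@compact_norm_le R n j%:R)).
  apply: le_trans (diff_le i (mball j)); apply: le_measure; rewrite ?inE//.
  by move=> x [_ []].
pose m1 : bmeasure R n := mrestr (diff i) (mD j).
have m1T : (m1 setT < +oo)%E by rewrite /m1 /= /mrestr setTI.
have mp1 : measurable_fun setT (potential alpha m1 : Rn R n -> \bar R).
  exact: measurable_potential.
have m1_sigma x : (potential alpha m1 x <= potential alpha (sigma i) x)%E.
  apply: le_mle_integral; [|exact: measurable_riesz|by move=> y; exact: riesz_ge0].
  move=> B mB; apply: le_trans (diff_le i mB).
  exact: le_mrestr.
pose F (l : nat) : set (Rn R n) := D j `&` [set x | (potential alpha m1 x <= l%:R%:E)%E].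
have mF l : measurable (F l).
  apply: measurableI => //; rewrite -[X in measurable X]setTI.
  exact: emeasurable_fun_infty_c.
have [l Fl0] : exists l, (0 < diff i (F l))%E.
  apply: bigcup_gt0 => //; rewrite (_ : \bigcup_l F l = D j)//.
  apply/seteqP; split => [x [l _ []]//|x Dx].
  have px : potential alpha m1 x \is a fin_num.
    rewrite ge0_fin_numE ?potential_ge0//; apply: (le_lt_trans (m1_sigma x)).
    by rewrite -ge0_fin_numE ?potential_ge0//; apply: sigma_fin; apply: EA; case: Dx.
  exists (Num.truncn (fine (potential alpha m1 x))).+1 => //.
  split => //=; rewrite -[leLHS]fineK// lee_fin; apply/ltW; exact: truncnS_gt.
have FDj : F l `<=` D j by exact: subIsetl.
have FlT : (diff i (F l) < +oo)%E.
  by apply: le_lt_trans DjT; apply: le_measure; rewrite ?inE.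
exists (F l), (mF l); split => //; first by move=> x /FDj[].
pose m2 : bmeasure R n := mrestr (diff i) (mF l).
have m2T : (m2 setT < +oo)%E by rewrite /m2 /= /mrestr setTI.
have bound (h : Rn R n -> \bar R) (c : R) : measurable_fun setT h ->
    (forall x, (0 <= h x)%E) -> (forall x, F l x -> (h x <= c%:E)%E) ->
    (\int[m2]_x h x < +oo)%E.
  move=> mh h0 hc; rewrite ge0_integral_mrestr//.
  apply: (@le_lt_trans _ _ (\int[diff i]_(x in F l) (cst `|c|%:E) x)%E).
    apply: ge0_le_integral => //; first exact: measurable_funTS.
    by move=> x Fx; apply: le_trans (hc x Fx) _; rewrite lee_fin ler_norm.
  by rewrite integral_cst// lte_mul_pinfty// lee_fin.
split => //; last first.
  by apply: (bound _ j%:R) => // x [[_ []]].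
apply: (@le_lt_trans _ _ (\int[m2]_x potential alpha m1 x)%E); last first.
  by apply: (bound _ l%:R) => //; [move=> x; exact: potential_ge0|move=> x []].
apply: ge0_le_integral => //.
- by move=> x _; exact: potential_ge0.
- exact: measurable_potential.
- move=> x _.
  apply: le_mle_integral; [|exact: measurable_riesz|by move=> y; exact: riesz_ge0].
  move=> B mB; rewrite /m1 /m2 /= /mrestr; apply: le_measure; rewrite ?inE.
  + exact: measurableI.
  + exact: measurableI.
  + exact: setIS.
Qed.

(** Positivity comes from the lower bound on [g i], finiteness from the upper bound [M i]. *)
Let weight_mass i m : (0 < m setT)%E -> (m setT < +oo)%E ->
  (0 < \int[m]_x (g i x)%:E < +oo)%E.
Proof.
move=> m0 mT; apply/andP; split.
  apply: (@lt_le_trans _ _ ((inf (range (g i)))%:E * m setT)%E).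
    by rewrite mule_gt0// lte_fin.
  rewrite -integral_cst//; apply: ge0_le_integral => //.
  - by move=> x _; rewrite lee_fin ltW.
  - exact: mg.
  - move=> x _; rewrite lee_fin; apply: ge_inf; last by exists x.
    by exists 0 => _ [y _ <-]; exact: ltW.
have M0 : 0 <= M i by apply: le_trans (g_bound i 0); exact: ltW.
apply: (@le_lt_trans _ _ ((M i)%:E * m setT)%E).
  rewrite -integral_cst//; apply: ge0_le_integral => //; first exact: mg.
  by move=> x _; rewrite lee_fin.
by rewrite lte_mul_pinfty// lee_fin.
Qed.

(* Otherwise a bit of mass of [lam i] where W > q g could be traded for mass
   of [sigma i - lam i] where W < p g, decreasing the Gauss functional. *)
Lemma solution_no_gap i (p q : R) : solutions alpha A s f a g sigma lam ->
  p < q -> (0 < lam i [set x | ((q * g i x)%:E < W i x)%E])%E ->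
  (0 < diff i (A i `&` [set x | (W i x < (p * g i x)%:E)%E]))%E -> False.
Proof.
move=> sol pq; set E1 := [set x | _] => E10.
set E := (_ `&` _) => E0.
have mE1 : measurable (E1 : set (Rn R n)) by exact: measurable_gap_gt.
have mE : measurable (E : set (Rn R n)).
  by apply: measurableI => //; exact: measurable_gap_lt.
have [F [mF [FE F0 tF]]] : exists F : set (Rn R n), exists mF : measurable F,
    [/\ F `<=` E, (0 < diff i F)%E & tame alpha f i (mrestr (diff i) mF)].
  apply: diff_restrict_tame => //; first exact: subIsetl.
  move=> x [_ /=]; rewrite WE; case: (f i x) => [r|//|//] _.
  by rewrite ltry.
have mE1C : measurable (~` E1 : set (Rn R n)) by exact: measurableC.
pose m0 : bmeasure R n := mrestr (lam i) mE1C.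
pose m1 : bmeasure R n := mrestr (lam i) mE1.
pose m2 : bmeasure R n := mrestr (diff i) mF.
have t0 : tame alpha f i m0 by apply: tame_mle (lam_tame i) => // B; exact: le_mrestr.
have t1 : tame alpha f i m1 by apply: tame_mle (lam_tame i) => // B; exact: le_mrestr.
have t2 : tame alpha f i m2 by [].
have m1T : m1 setT = lam i E1 by rewrite /m1 /= /mrestr setTI.
have m2T : m2 setT = diff i F by rewrite /m2 /= /mrestr setTI.
have /andP[c1p c1f] : (0 < \int[m1]_x (g i x)%:E < +oo)%E.
  by apply: weight_mass; [rewrite m1T|have [] := t1].
have /andP[c2p c2f] : (0 < \int[m2]_x (g i x)%:E < +oo)%E.
  by apply: weight_mass; [rewrite m2T|have [] := t2].
set c1 := (\int[m1]_x (g i x)%:E)%E in c1p c1f *.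
set c2 := (\int[m2]_x (g i x)%:E)%E in c2p c2f *.
have c1E : c1 = (fine c1)%:E by rewrite fineK// ge0_fin_numE// ltW.
have c2E : c2 = (fine c2)%:E by rewrite fineK// ge0_fin_numE// ltW.
have r1 : 0 < fine c1 by rewrite -lte_fin -c1E.
have r2 : 0 < fine c2 by rewrite -lte_fin -c2E.
(* Both fractions are at most 1, and [u1 c1 = u2 c2]: the weighted mass taken away equals the
   weighted mass added. *)
pose u1 := fine c2 / (fine c1 + fine c2); pose u2 := fine c1 / (fine c1 + fine c2).
have r12 : 0 < fine c1 + fine c2 by lra.
have u10 : 0 < u1 by rewrite divr_gt0.
have u20 : 0 < u2 by rewrite divr_gt0.
have u11 : 0 <= 1 - u1 by rewrite subr_ge0 ler_pdivrMr// mul1r; lra.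
have u21 : u2 <= 1 by rewrite ler_pdivrMr// mul1r; lra.
have ue : u1 * fine c1 = u2 * fine c2 by rewrite /u1 /u2; ring.
have lamE (h : Rn R n -> \bar R) : measurable_fun setT h -> (forall x, (0 <= h x)%E) ->
    (\int[lam i]_x h x = \int[mix (NngNum ler01) (NngNum ler01) m0 m1]_x h x)%E.
  move=> mh h0; rewrite ge0_integral_mix//= !mul1e !ge0_integral_mrestr//.
  rewrite -ge0_integral_setU//; first by rewrite setUC setUv.
  - by rewrite setUC setUv.
  - by apply/disj_setPS => x [].
have linfE : L i (lam i) = L i m0 + L i m1.
  transitivity (L i (mix (NngNum ler01) (NngNum ler01) m0 m1)); last first.
    by rewrite /L linf_mix//= !mul1r.
  rewrite /L /linf lamE//; congr (_ + _); apply: eq_bigr => j _.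
  rewrite /energy lamE//; first exact: measurable_potential.
  by move=> x; exact: potential_ge0.
(* [m0 + (1 - u1) m1 + u2 m2]: the fraction [u1] of [lam i] on [E1] is given up for the fraction
   [u2] of [diff i] on [F]. It stays below [sigma i] because [m0 + m1 = lam i] and
   [u2 m2 <= diff i]. *)
pose k := mix (NngNum ler01) (NngNum (ltW u20))
  (mix (NngNum ler01) (NngNum u11) m0 m1) m2.
have adk : admissible1 i k.
  split.
  - by apply: tame_mix => //; exact: tame_mix.
  - have z (m : bmeasure R n) (B : set (Rn R n)) (mB : measurable B) :
        m (~` A i) = 0%E -> mrestr m mB (~` A i) = 0%E.
      move=> mz; have := le_mrestr m mB (mAC i); rewrite mz => h.
      by apply/eqP; rewrite eq_le h measure_ge0.
    have z0 : m0 (~` A i) = 0%E := z _ _ mE1C (lamA i).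
    have z1 : m1 (~` A i) = 0%E := z _ _ mE1 (lamA i).
    have z2 : m2 (~` A i) = 0%E := z _ _ mF (diffA i).
    by rewrite /k !mixE z0 z1 z2 !(mule0, adde0).
  - move=> B mB; rewrite /k !mixE /= !mul1e sigmaE//; apply: leeD.
      rewrite /m0 /m1 /= /mrestr.
      rewrite -[B in leRHS]setIT -(setUv E1) setUC setIUr measureU//; last 3 first.
        exact: measurableI.
        exact: measurableI.
        by rewrite setIACA setICl setI0.
      apply: leeD => //; rewrite -[leRHS]mul1e lee_wpmul2r// lee_fin.
      by rewrite gerBl ltW.
    rewrite /m2 /= /mrestr; apply: (@le_trans _ _ (1%:E * diff i (B `&` F))%E).
      by rewrite lee_wpmul2r// lee_fin.
    by rewrite mul1e; exact: le_mrestr.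
  - have [_ _ _ gl] := lam1 i.
    have mgi := mg i.
    rewrite /k ge0_integral_mix//.
    rewrite ge0_integral_mix//.
    rewrite -/c1 -/c2 /= !mul1e -gl lamE//.
    rewrite ge0_integral_mix//.
    rewrite -/c1 /= !mul1e -addeA; congr (_ + _)%E.
    by rewrite c1E c2E -!EFinM -EFinD -ue; congr (_%:E); ring.
have := solution_linf1 sol adk.
have tm := tame_mix alpha_ltn mf f_ge0 (NngNum ler01) (NngNum u11) t0 t1.
rewrite /L /k linf_mix//= linf_mix//= -/L linfE.
have [i1 e1] := integral_wpotential alpha_ltn s mf f_ge0 lam_tame t1.
have [i2 e2] := integral_wpotential alpha_ltn s mf f_ge0 lam_tame t2.
have ig (v : R) (m : bmeasure R n) : (\int[m]_x (g i x)%:E < +oo)%E ->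
    m.-integrable setT (fun x : Rn R n => (v%:E * (g i x)%:E)%E) /\
    (\int[m]_x (v%:E * (g i x)%:E) = v%:E * \int[m]_x (g i x)%:E)%E.
  move=> gm; have ii := weight_integrable gm.
  by split; [exact: integrableZl|rewrite integralZl].
(* The exchange changes [L i] by [u2 L(m2) - u1 L(m1) <= (p - q) u1 c1 < 0], against minimality. *)
have b1 : q * fine c1 <= L i m1.
  rewrite -lee_fin -e1 EFinM -c1E -(ig q m1 c1f).2.
  apply: (le_integral_conull mE1) => //.
  - by rewrite /m1 /= /mrestr setICl measure0.
  - exact: (ig q m1 c1f).1.
  - by move=> x; rewrite /E1 /= EFinM => /ltW.
have b2 : L i m2 <= p * fine c2.
  rewrite -lee_fin -e2 EFinM -c2E -(ig p m2 c2f).2.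
  apply: (le_integral_conull mF) => //.
  - by rewrite /m2 /= /mrestr setICl measure0.
  - exact: (ig p m2 c2f).1.
  - by move=> x /FE[_ /=]; rewrite EFinM => /ltW.
have b3 : u2 * L i m2 <= u1 * (p * fine c1).
  by rewrite mulrCA ue mulrCA ler_wpM2l// ltW.
have b4 : u1 * (q * fine c1) <= u1 * L i m1 by rewrite ler_wpM2l// ltW.
have b5 : u1 * (p * fine c1) < u1 * (q * fine c1).
  by rewrite ltr_pM2l// ltr_pM2r.
have := le_lt_trans b3 (lt_le_trans b5 b4).
move: (L i m0) (L i m1) (L i m2) => l0 l1 l2 b6.
by rewrite !mul1r mulrBl mul1r leNgt -!addrA ltrD2l gtrDl addrC subr_lt0 b6.
Qed.

(** Argued with a sequence approaching [x] from outside the set, since continuity of [V i] is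
    available along sequences. *)
Lemma gap_gt_open i (w : R) : open [set x | ((w * g i x)%:E < W i x)%E].
Proof.
rewrite openE => x /= Wx; apply: contrapT => nx.
have /choice[u hu] : forall j : nat, exists y,
    ball x j.+1%:R^-1 y /\ (W i y <= (w * g i y)%:E)%E.
  move=> j; apply: contrapT => /forallNP h; apply: nx; apply/nbhs_ballP.
  exists j.+1%:R^-1; first by rewrite /= invr_gt0.
  by move=> y xy /=; rewrite ltNge; apply/negP => Wy; exact: (h y (conj xy Wy)).
have ux : u k @[k --> \oo] --> x.
  apply/cvg_ballP => e e0; have := near_infty_natSinv_lt (PosNum e0).
  apply: filterS => j je; apply: (le_ball (ltW je)).
  by have [] := hu j.
have b_cvg : w * g i (u k) - V i (u k) @[k --> \oo] --> w * g i x - V i x.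
  apply: cvgB; last exact: V_cvg.
  by apply: cvgM; [exact: cvg_cst|exact: (cvg_comp _ _ ux (@g_cont i x))].
(* A real level strictly in between, which exists even if [f i x = +oo]: along [u], the field ends
   up above it by lower semicontinuity and [w g_i - V i] below it by continuity. *)
have [c bc cf] : exists2 c, w * g i x - V i x < c & (c%:E < f i x)%E.
  move: Wx; rewrite WE; case: (f i x) (f_ge0 i x) => [r _|_ _|//].
    rewrite -EFinD lte_fin => h; exists ((w * g i x - V i x + r) / 2).
      by rewrite ltr_pdivlMr//; lra.
    by rewrite lte_fin ltr_pdivrMr//; lra.
  by exists (w * g i x - V i x + 1); [lra|rewrite ltry].
have h1 : \forall k \near \oo, (c%:E < f i (u k))%E.
  have [U nU hU] := f_lsc cf.
  have h : \forall k \near \oo, U (u k) by exact: (ux _ nU).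
  by apply: filterS h => j Uj; exact: hU.
have h2 : \forall k \near \oo, w * g i (u k) - V i (u k) < c.
  exact: (cvgr_lt _ b_cvg).
have [j _ hj] := filterI h1 h2.
have [hj1 hj2] := hj j (leqnn j).
have [_] := hu j; rewrite WE; case: (f i (u j)) hj1 => [r|_|//].
  rewrite lte_fin -EFinD lee_fin => cr; have := lt_trans hj2 cr.
  by rewrite ltrBlDl ltNge => /negP.
by rewrite addey// leye_eq.
Qed.

Let V_bound i x : exists j : nat, `|V i x| < j%:R * g i x.
Proof.
exists (Num.truncn (`|V i x| / g i x)).+1.
by rewrite -ltr_pdivrMr//; exact: truncnS_gt.
Qed.

(** The threshold is the supremum of the levels [q] for which [lam i] charges the set where
    [W i > q g_i]. By [solution_no_gap] each such [q] is at most every [p] for which [diff i]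
    charges the set where [W i < p g_i]. *)
Lemma solution_threshold i : solutions alpha A s f a g sigma lam ->
  exists w : R,
    {ae diff i, forall x, A i x -> ((w * g i x)%:E <= W i x)%E} /\
    (forall x, msupport (lam i) x -> (W i x <= (w * g i x)%:E)%E).
Proof.
move=> sol.
pose U (q : R) : set (Rn R n) := [set x | ((q * g i x)%:E < W i x)%E].
pose D (p : R) : set (Rn R n) := A i `&` [set x | (W i x < (p * g i x)%:E)%E].
have mU q : measurable (U q) by exact: measurable_gap_gt.
have mD p : measurable (D p).
  by apply: measurableI => //; exact: measurable_gap_lt.
have gap p q : (0 < lam i (U q))%E -> (0 < diff i (D p))%E -> q <= p.
  by move=> hq hp; rewrite leNgt; apply/negP => pq; exact: solution_no_gap pq hq hp.
pose S := [set q | (0 < lam i (U q))%E].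
have [_ _ _ gl] := lam1 i.
(* [lam i] is nonzero because its weighted mass is [a i > 0], and [W i > -oo] everywhere because
   [f i >= 0]. *)
have [q0 Sq0] : S !=set0.
  have l0 : (0 < lam i setT)%E.
    rewrite lt_neqAle measure_ge0 andbT eq_sym; apply/eqP => l0.
    have e : (\int[lam i]_x (g i x)%:E = 0)%E.
      rewrite (ge0_integral_conull measurable0 _ (mg i) (g0 i)) ?setC0//.
      exact: integral_set0.
    by move: (a_gt0 i); rewrite -lte_fin -gl e ltxx.
  pose Un (j : nat) := U (- j%:R).
  have [j hj] : exists j, (0 < lam i (Un j))%E.
    apply: bigcup_gt0 => [j|]; first exact: mU.
    rewrite (_ : \bigcup_j Un j = setT)//.
    apply/seteqP; split => // x _; have [j hj] := V_bound i x.
    exists j => //=; rewrite /Un /U /= WE; case: (f i x) (f_ge0 i x) => [r|_|//].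
      rewrite lee_fin -EFinD lte_fin => r0; rewrite mulNr.
      by move: hj; rewrite ltr_norml => /andP[]; lra.
    by rewrite addey// ltry.
  by exists (- j%:R).
(* [diff i] is nonzero because [sigma i] has larger weighted mass than [lam i]; as [f i] is finite
   almost everywhere for it, some level [p0] is charged, and this level bounds [S] from above. *)
have [p0 Dp0] : exists p0, (0 < diff i (D p0))%E.
  have mfin : measurable ([set x | A i x /\ f i x = +oo%E] : set (Rn R n)).
    rewrite (_ : [set x | _] = A i `&` f i @^-1` [set +oo%E])//.
    apply: measurableI => //; rewrite -[X in measurable X]setTI.
    exact: mf.
  have dfin : diff i [set x | A i x /\ f i x = +oo%E] = 0%E.
    apply/eqP; rewrite eq_le measure_ge0 andbT -(sigma_field i).
    exact: diff_le.
  have d0 : (0 < diff i setT)%E.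
    rewrite lt_neqAle measure_ge0 andbT eq_sym; apply/eqP => d0.
    have := sigma_mass i; rewrite -gl.
    rewrite (@eq_measure_integral _ _ _ _ (lam i) (sigma i)) ?ltxx// => B mB _.
    rewrite sigmaE// (_ : diff i B = 0%E) ?adde0//.
    by apply: (subset_measure0 mB measurableT (@subsetT _ _) d0).
  pose Dn (j : nat) := D j%:R.
  have mDn j : measurable (Dn j) by exact: mD.
  have [j hj] : exists j, (0 < diff i (Dn j))%E.
    apply: bigcup_gt0 => //; apply: (lt_le_trans d0).
    have mUD : measurable (\bigcup_j Dn j) by exact: bigcup_measurable.
    have sub : setT `<=` (~` A i `|` [set x | A i x /\ f i x = +oo%E]) `|` \bigcup_j Dn j.
      move=> x _; have [Ax|] := pselect (A i x); last by left; left.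
      have [fx|fx] := pselect (f i x = +oo%E); first by left; right.
      right; have ff : f i x \is a fin_num by rewrite ge0_fin_numE// ltey; exact/eqP.
      exists (Num.truncn ((V i x + fine (f i x)) / g i x)).+1 => //.
      split => //=; rewrite WE -(fineK ff) -EFinD lte_fin -ltr_pdivrMr//.
      exact: truncnS_gt.
    have mN : measurable (~` A i `|` [set x | A i x /\ f i x = +oo%E] : set (Rn R n)).
      exact: measurableU.
    apply: (@le_trans _ _ (diff i ((~` A i `|` [set x | A i x /\ f i x = +oo%E])
        `|` \bigcup_j Dn j))).
      by apply: le_measure; rewrite ?inE//; exact: measurableU.
    rewrite setUC measureU0//; exact: (null_set_setU (mAC i) mfin (diffA i) dfin).
  by exists j%:R.
have supS : has_sup S.
  by split; [exists q0|exists p0 => q Sq; exact: gap Sq Dp0].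
pose w := sup S.
(* Exceeding [w g_i] strictly means exceeding it at some level [w + 1/(j+1)]; a charged level of
   this kind would be an element of [S] above its supremum. *)
have Uw : lam i (U w) = 0%E.
  apply/eqP; rewrite eq_le measure_ge0 andbT leNgt; apply/negP => Uw0.
  pose Un (j : nat) := U (w + j.+1%:R^-1).
  have [j hj] : exists j, (0 < lam i (Un j))%E.
    apply: bigcup_gt0 => [j|]; first exact: mU.
    rewrite (_ : \bigcup_j Un j = U w)//.
    apply/seteqP; split => x.
      move=> [j _]; apply: le_lt_trans; rewrite lee_fin ler_pM2r//.
      by rewrite lerDl invr_ge0.
    rewrite /U /= WE; case fE : (f i x) (f_ge0 i x) => [r| |] // _.
      rewrite -EFinD lte_fin -subr_gt0 => h.
      have hg : 0 < (V i x + r - w * g i x) / g i x by rewrite divr_gt0.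
      have [j _ hj] := near_infty_natSinv_lt (PosNum hg).
      exists j => //; rewrite /Un /U /= WE fE -EFinD lte_fin mulrDl.
      by have := hj j (leqnn j); rewrite /= ltr_pdivlMr// ltrBrDl.
    by move=> _; exists 0 => //; rewrite /Un /U /= WE fE addey// ltry.
  have := sup_upper_bound supS hj; rewrite -/w gerDl leNgt => /negP; apply.
  by rewrite invr_gt0.
(* Dually, a charged level [w - 1/(j+1)] would bound [S] through [gap] by a number below its
   supremum. *)
have Dw : diff i (D w) = 0%E.
  apply/eqP; rewrite eq_le measure_ge0 andbT leNgt; apply/negP => Dw0.
  pose Dn (j : nat) := D (w - j.+1%:R^-1).
  have [j hj] : exists j, (0 < diff i (Dn j))%E.
    apply: bigcup_gt0 => [j|]; first exact: mD.
    rewrite (_ : \bigcup_j Dn j = D w)//.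
    apply/seteqP; split => x.
      move=> [j _ [Ax /= h]]; split => //=; apply: (lt_le_trans h).
      by rewrite lee_fin ler_pM2r// gerBl invr_ge0.
    move=> [Ax]; rewrite /= WE; case fE : (f i x) (f_ge0 i x) => [r| |] // _.
    rewrite -EFinD lte_fin -subr_gt0 => h.
    have hg : 0 < (w * g i x - (V i x + r)) / g i x by rewrite divr_gt0.
    have [j _ hj] := near_infty_natSinv_lt (PosNum hg).
    exists j => //=; split => //=; rewrite WE fE -EFinD lte_fin mulrBl.
    by have := hj j (leqnn j); rewrite /= ltr_pdivlMr// ltrBrDl -ltrBrDr.
  have d0 : 0 < j.+1%:R^-1 :> R by rewrite invr_gt0.
  have [q Sq wq] := sup_adherent d0 supS.
  by have := gap _ _ Sq hj; rewrite leNgt wq.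
exists w; split.
  exists (D w); split => // x /= /not_implyP[Ax /negP]; rewrite -ltNge => h.
  by split.
(* The set where [W i > w g_i] is open and null for [lam i], hence misses the support; this turns an
   almost everywhere bound into one at every point of the support. *)
move=> x Sx; rewrite leNgt; apply/negP => Wx.
by have := Sx _ (@gap_gt_open i w) Wx; rewrite Uw ltxx.
Qed.

End constrained_problem.

Theorem theorem9p2 (R : realType) (n : nat) (alpha : R) (I : finType)
    (A : I -> set 'rV[R]_n) (s : I -> R)
    (f : I -> 'rV[R]_n -> \bar R) (a : I -> R) (g : I -> 'rV[R]_n -> R)
    (M : I -> R) (sigma lambda : I -> bmeasure R n)
    (n_ge3 : (3 <= n)%N)
    (alpha_gt0 : 0 < alpha) (alpha_ltn : alpha < n%:R)
    (condA : condenser alpha A s)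
    (a_gt0 : forall i, 0 < a i)
    (g_gt0 : forall i x, 0 < g i x)
    (g_cont : forall i, continuous (g i))
    (g_inf : forall i, 0 < inf (range (g i)))
    (sigmaC : constraints A a g sigma)
    (sigma_fin : forall i x, A i x ->
       potential alpha (sigma i) x \is a fin_num)
    (sigma_cont : forall i,
       {within A i, continuous (potential alpha (sigma i))})
    (sigma_infty : forall i, exists K : set 'rV[R]_n, compact K /\
       exists C : R, forall x, ~ K x ->
         (potential alpha (sigma i) x <= C%:E)%E)
    (sigma_reg : forall i, sigma i (A i `\` regular_part A s f i) = 0%E)
    (caseI : case_I f)
    (g_bound : forall i x, g i x <= M i)
    (lambda_adm : admissible alpha A s f a g sigma lambda) :
  solutions alpha A s f a g sigma lambda <->
  exists w : I -> R, forall i,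
    {ae mdiff (sigma i) (lambda i), forall x, A i x ->
       ((w i * g i x)%:E <= wpotential alpha s f lambda i x)%E} /\
    (forall x, msupport (lambda i) x ->
       (wpotential alpha s f lambda i x <= (w i * g i x)%:E)%E).
Proof.
have [A_ne_cl _ _ _] := condA.
have A_neq0 i : A i !=set0 by have [] := A_ne_cl i.
have A_closed i : closed (A i) by have [] := A_ne_cl i.
have [sigma_v sigma_c] := sigmaC.
have sigma_radon i : radon (sigma i) by have [] := sigma_v i.
have sigma_supp i : msupport (sigma i) `<=` A i by have [] := sigma_v i.
have sigma_mass i : ((a i)%:E < \int[sigma i]_x (g i x)%:E)%E.
  by have [] := sigma_c i.
have f_ge0 i x : (0 <= f i x)%E by have [] := caseI i.
have f_lsc i : lower_semicontinuous (f i) by have [] := caseI i.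
have mf i : measurable_fun setT (f i : Rn R n -> \bar R).
  exact: lsc_Rn_measurable.
have mA i : measurable (A i : set (Rn R n)) by exact: closed_Rn_measurable.
have mtouch : measurable (touching A s : set (Rn R n)).
  by apply: measurableI; apply: (@fin_bigcup_measurable _ (Rn R n) _ _ A).
have mfoo i : measurable ([set x | f i x = +oo%E] : set (Rn R n)).
  rewrite -[X in measurable X]setTI.
  exact: (mf i measurableT _ (emeasurable_set1 +oo%E)).
have mreg i : measurable (A i `\` regular_part A s f i : set (Rn R n)).
  rewrite (_ : _ `\` _ =
      A i `&` (touching A s `|` [set x | f i x = +oo%E])).
    by apply: measurableI => //; exact: measurableU.
  apply/seteqP; split => x /= [Ax h]; split => //.
    have [tx|tx] := pselect (touching A s x); first by left.
    right; apply: contrapT => fx; apply: h; split => //.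
    by rewrite gee0_abs// ltey; exact/eqP.
  by move=> [_ tx fx]; case: h => // e; move: fx; rewrite e.
have sigma_field i : sigma i [set x | A i x /\ f i x = +oo%E] = 0%E.
  apply: (subset_measure0 _ (mreg i) _ (sigma_reg i)).
    exact: (measurableI _ _ (mA i) (mfoo i)).
  by move=> x /= [Ax fx]; split => // -[_ _]; rewrite fx.
split=> [sol|[w hw]].
  suff h i : exists w : R,
      {ae mdiff (sigma i) (lambda i), forall x, A i x ->
         ((w * g i x)%:E <= wpotential alpha s f lambda i x)%E} /\
      (forall x, msupport (lambda i) x ->
         (wpotential alpha s f lambda i x <= (w * g i x)%:E)%E).
    by have [w hw] := choice h; exists w.
  exact: (solution_threshold alpha_ltn A_neq0 A_closed a_gt0 g_gt0 g_cont g_inf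
    g_bound f_ge0 f_lsc sigma_radon sigma_supp sigma_mass sigma_fin sigma_cont
    sigma_field lambda_adm i sol).
apply: (linf_solution alpha_ltn) => // mu i amu; have [hw1 hw2] := hw i.
exact: (variational_linf alpha_ltn A_closed g_gt0 g_cont g_inf f_ge0 f_lsc
  lambda_adm amu hw1 hw2).
Qed.
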